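(* Let $p\ge 3$ be a prime number and let $\vec G=(V,\vec E)$ be a directed graph whose underlying undirected graph is $(6p-8)(p-1)$-edge-connected. For each arc $\vec e\in\vec E$, let $L(\vec e)$ be a set of two distinct elements of $\mathbb{Z}_p$. Then for every $\mathbb{Z}_p$-boundary $\beta$, $\vec G$ has a $\mathbb{Z}_p$-flow $f$ with boundary $\beta$ such that $f(\vec e)\in L(\vec e)$ for every $\vec e\in\vec E$.
   Context: Graphs are finite and may have multiple edges but no loops. A $\mathbb{Z}_p$-boundary is a map $\beta:V\to\mathbb{Z}_p$ with $\sum_{v\in V}\beta(v)\equiv 0\pmod p$. For $v\in V$, $\delta^+_{\vec G}(v)$ (resp. $\delta^-_{\vec G}(v)$) is the set of arcs leaving (resp. entering) $v$. A $\mathbb{Z}_p$-flow with boundary $\beta$ in $\vec G$ is a map $f:\vec E\to\mathbb{Z}_p$ such that $\partial f(v):=\sum_{\vec e\in\delta^+_{\vec G}(v)}f(\vec e)-\sum_{\vec e\in\delta^-_{\vec G}(v)}f(\vec e)\equiv\beta(v)\pmod p$ for every $v\in V$. *)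

(* Defs.v *)
From HB Require Import structures.
From mathcomp Require Import all_boot all_order all_algebra.
Set Implicit Arguments. Unset Strict Implicit. Unset Printing Implicit Defensive.
Import GRing.Theory.
Local Open Scope ring_scope.

(* A directed multigraph on vertex set V with arc set E: each arc e goes from
   [tail e] to [head e].  Multiple arcs allowed; loops are excluded by the
   hypothesis [loopless]. *)
Definition loopless (V E : finType) (tail head : E -> V) : Prop :=
  forall e : E, tail e != head e.

Definition cut_arcs (V E : finType) (tail head : E -> V) (X : {set V})
  : {set E} :=
  [set e : E | (tail e \in X) != (head e \in X)].

(* The underlying undirected graph is k-edge-connected: deleting any fewer
   than k edges leaves it connected, i.e. every edge cut delimited by a
   nonempty proper vertex subset X has at least k edges. *)
Definition edge_connected (V E : finType) (tail head : E -> V) (k : nat) : Prop :=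
  forall X : {set V}, X != set0 -> X != [set: V] ->
    (k <= #|cut_arcs tail head X|)%N.

Definition is_boundary (p : nat) (V : finType) (beta : V -> 'Z_p) : Prop :=
  \sum_(v : V) beta v = 0.

Definition flow_boundary (p : nat) (V E : finType) (tail head : E -> V)
  (f : E -> 'Z_p) (v : V) : 'Z_p :=
  \sum_(e : E | tail e == v) f e - \sum_(e : E | head e == v) f e.

Definition is_flow_with_boundary (p : nat) (V E : finType) (tail head : E -> V)
  (f : E -> 'Z_p) (beta : V -> 'Z_p) : Prop :=
  forall v : V, flow_boundary tail head f v = beta v.

(* Main.v *)
(** A list {a, b} on an arc e amounts to a choice of g in {0, 1} contributing g (b - a), so
    that every arc carries a nonzero weight. As all degrees are at least (6p-8)(p-1), some
    class {c, -c} of weights has at least (6p-8)|V| arcs, hence there is a set A of at least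
    two vertices on which this class induces a (4p-2)-edge-connected graph. Contract A,
    apply induction, and correct the flow inside A with the arcs of this class: this is
    possible because a (4p-2)-edge-connected graph has an orientation with any prescribed
    net outdegrees modulo p of total zero.

    The latter is a weak form of a theorem of Lovász, Thomassen, Wu and Zhang, whose method
    is followed. Put k = p and let tau(A) be the representative in [-k, k] of the net outflow
    wanted on A, modulo 2k and of the same parity as d(A). One adds a vertex z0 with
    pre-directed arcs, with d(z0) <= 4k-2+|tau(z0)|, and requires d(A) >= 3k-1+|tau(A)| for
    the sets A avoiding z0. If equality holds for some A with at least two elements, contract
    A, then contract its complement. Otherwise there is room for deleting or lifting edges.
    When no such operation applies, one may assume that all targets are positive and that z0
    is a source; then edges yx are oriented from y to x and replaced by arcs z0 -> x.
    Once d(z0) = 4k-1, this goes on with a fixed x, until there are k arcs z0 -> x; these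
    can be reversed for free modulo 2k. *)
Require Import Defs.
From HB Require Import structures.
From mathcomp Require Import all_boot all_order all_algebra.
From mathcomp Require Import zify ring.
Set Implicit Arguments. Unset Strict Implicit. Unset Printing Implicit Defensive.
Import Order.TTheory GRing.Theory Num.Theory.

(** * Residues modulo 2k *)

Section Norm.
Variable k : nat.
Hypothesis k0 : 0 < k.

Definition modulus : int := Posz (2 * k).
Definition residue (x : int) : nat := `|(x %% modulus)%Z|.
(** The absolute value of the representative of x in [-k, k]. *)
Definition cdist (x : int) : nat := minn (residue x) (2 * k - residue x).
(* The residue k is both positive and negative. *)
Definition pos (x : int) : bool := 0 < residue x <= k.
Definition neg (x : int) : bool := k <= residue x.
Definition cong (x y : int) : bool := (modulus %| (x - y)%R)%Z.

Lemma residueE (x q : int) (r : nat) : r < 2 * k -> x = (q * modulus + r%:Z)%R -> residue x = r.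
Proof. by move=> h ->; rewrite /residue modzMDl modz_small // /modulus; lia. Qed.

Lemma residue_lt x : residue x < 2 * k.
Proof.
rewrite /residue; have h : modulus != 0 by rewrite /modulus; lia.
have := modz_ge0 x h; have : (0 < modulus)%R by rewrite /modulus; lia.
by move/(ltz_pmod x); rewrite /modulus; lia.
Qed.

Lemma residueP (x : int) : {q : int | x = (q * modulus + (residue x)%:Z)%R}.
Proof.
exists (x %/ modulus)%Z; rewrite {1}(divz_eq x modulus) /residue gez0_abs // modz_ge0 //.
by rewrite /modulus; lia.
Qed.

Lemma congP x y : reflect (exists q, x = (y + q * modulus)%R) (cong x y).
Proof.
apply: (iffP idP) => [/dvdzP[q h]|[q ->]]; first by exists q; rewrite -h; ring.
by apply/dvdzP; exists q; ring.
Qed.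

Lemma cong_residue x y : cong x y -> residue x = residue y.
Proof.
move/congP=> [q ->]; have [p hp] := residueP y.
by rewrite {1}hp; apply: (@residueE _ (p + q)%R); [apply: residue_lt | ring].
Qed.

Lemma cong_cdist x y : cong x y -> cdist x = cdist y.
Proof. by rewrite /cdist => /cong_residue ->. Qed.

Lemma residueS x : residue (x + 1)%R = if residue x == (2 * k).-1 then 0 else (residue x).+1.
Proof.
have [q hq] := residueP x; have := residue_lt x.
case: eqP => h l; rewrite {1}hq.
  by apply: (@residueE _ (q + 1)%R); [lia | rewrite h /modulus; have -> : Posz (2 * k).-1 = (Posz (2 * k) - 1)%R by lia]; ring.
by apply: (@residueE _ q); [lia | rewrite -addn1 PoszD; ring].
Qed.

Lemma residueN x : residue (- x)%R = if residue x == 0 then 0 else 2 * k - residue x.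
Proof.
have [q hq] := residueP x; have l := residue_lt x.
case: eqP => h; rewrite {1}hq.
  by apply: (@residueE _ (- q)%R); [lia | rewrite h; ring].
apply: (@residueE _ (- q - 1)%R); first by lia.
by have -> : ((2 * k - residue x)%N%:Z = modulus - (residue x)%:Z)%R; [rewrite /modulus; lia | ring].
Qed.

Lemma cdistN x : cdist (- x)%R = cdist x.
Proof. by rewrite /cdist residueN; have := residue_lt x; case: eqP; lia. Qed.

Lemma negE x : neg x = pos (- x)%R.
Proof. by rewrite /neg /pos residueN; have := residue_lt x; case: eqP; lia. Qed.

(** A residue in [k, 2k) approaches 2k, that is zero, when 1 is added. A deletion that lowers a
    degree by one and moves the target this way leaves degree minus [cdist] unchanged. *)
Lemma cdist_neg x : neg x -> (cdist (x + 1)%R).+1 = cdist x.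
Proof. by rewrite /neg /cdist residueS; have := residue_lt x; case: eqP; lia. Qed.

Lemma cdist_pos x : pos x -> (cdist (x - 1)%R).+1 = cdist x.
Proof. by move=> h; rewrite -cdistN opprB addrC cdist_neg ?cdistN // negE opprK. Qed.

Lemma cong0E x : cong x 0 = (residue x == 0).
Proof.
apply/idP/eqP => [/cong_residue ->|h]; first by rewrite /residue mod0z.
by apply/congP; have [q ->] := residueP x; exists q; rewrite h; ring.
Qed.

Lemma sgn3 x : [|| cong x 0, pos x | neg x].
Proof. by rewrite cong0E /pos /neg; lia. Qed.

Lemma cdist_le x : cdist x <= k.
Proof. by rewrite /cdist; lia. Qed.

Lemma cdist_nat (n q : nat) : cdist (Posz (n + q * (2 * k))) = cdist (Posz n).
Proof. by apply/cong_cdist/congP; exists (Posz q); rewrite /modulus; lia. Qed.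

Lemma cdist_small n : n <= k -> cdist (Posz n) = n.
Proof.
move=> h; rewrite /cdist (@residueE _ 0 n) ?mul0r ?add0r //; lia.
Qed.

Lemma cdistD x y : cdist (x + y)%R <= cdist x + cdist y.
Proof.
have [q hq] := residueP x; have [p hp] := residueP y.
have lx := residue_lt x; have ly := residue_lt y.
have [h|h] := ltnP (residue x + residue y) (2 * k).
  rewrite {1}/cdist (@residueE _ (q + p)%R (residue x + residue y)) //.
    by rewrite /cdist; lia.
  by rewrite {1}hq {1}hp PoszD; ring.
rewrite {1}/cdist (@residueE _ (q + p + 1)%R (residue x + residue y - 2 * k)) //.
- by rewrite /cdist; lia.
- by lia.
rewrite {1}hq {1}hp.
have -> : ((residue x + residue y - 2 * k)%N%:Z = (residue x)%:Z + (residue y)%:Z - modulus)%R by rewrite /modulus; lia.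
by ring.
Qed.

(** The modulus 2k is even, so reduction and reflection keep the parity. *)
Lemma cdist_odd x : odd (cdist x) = odd `|x|.
Proof.
have [q hq] := residueP x; have l := residue_lt x.
suff -> : odd `|x| = odd (residue x) by rewrite /cdist; lia.
by rewrite {1}hq /modulus; lia.
Qed.

Lemma congxx x : cong x x.
Proof. by rewrite /cong subrr dvdz0. Qed.

Lemma cong_eq x y : x = y -> cong x y.
Proof. by move=> ->; apply: congxx. Qed.

Lemma cong_sym x y : cong x y = cong y x.
Proof. by rewrite /cong -opprB; apply: rpredN. Qed.

Lemma cong_trans y x z : cong x y -> cong y z -> cong x z.
Proof. by move=> h1 h2; have := rpredD h1 h2; rewrite addrA subrK. Qed.

Lemma congD x y x' y' : cong x y -> cong x' y' -> cong (x + x')%R (y + y')%R.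
Proof. by move=> h1 h2; rewrite /cong opprD addrACA; apply: rpredD. Qed.

Lemma congN x y : cong x y -> cong (- x)%R (- y)%R.
Proof. by rewrite /cong -opprD rpredN. Qed.

Lemma cong_sum (I : finType) (P : pred I) (F G : I -> int) :
  (forall i, P i -> cong (F i) (G i)) -> cong (\sum_(i | P i) F i)%R (\sum_(i | P i) G i)%R.
Proof. by move=> h; rewrite /cong -sumrB; apply: rpred_sum. Qed.

End Norm.

(** * Sums over vertex sets after a change at one vertex *)

Section Sums.
Variable V : finType.
Implicit Types (A : {set V}) (x v : V).

Lemma sum_bump (F : V -> nat) n x A :
  \sum_(v in A) (F v + n * (v == x)) = \sum_(v in A) F v + n * (x \in A).
Proof.
rewrite big_split /=; congr (_ + _); rewrite -big_distrr /=; congr (_ * _).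
have [h|h] := boolP (x \in A).
  rewrite (bigD1 x) //= eqxx big1 ?addn0 // => v /andP[_ /negbTE ->] //.
by rewrite big1 // => v hv; case: eqP => // e; rewrite -e hv in h.
Qed.

Lemma sum_drop (F : V -> nat) n x A : n <= F x ->
  \sum_(v in A) (F v - n * (v == x)) + n * (x \in A) = \sum_(v in A) F v.
Proof.
move=> h; rewrite -sum_bump; apply: eq_bigr => v _.
by case: eqP => [->|_]; lia.
Qed.

Lemma sum_bumpz (F : V -> int) (d : int) x A :
  (\sum_(v in A) (F v + d * Posz (v == x)) = \sum_(v in A) F v + d * Posz (x \in A))%R.
Proof.
rewrite big_split /=; congr (_ + _)%R; rewrite -big_distrr /=; congr (_ * _)%R.
have [h|h] := boolP (x \in A).
  rewrite (bigD1 x) //= eqxx big1 ?addr0 // => v /andP[_ /negbTE ->] //.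
by rewrite big1 // => v hv; case: eqP => // e; rewrite -e hv in h.
Qed.

Lemma sum_ind x A : \sum_(v in A) (x == v : nat) = (x \in A).
Proof.
have := sum_bump (fun=> 0) 1 x A; rewrite big1_eq mul1n add0n => <-.
by apply: eq_bigr => v _; rewrite eq_sym; lia.
Qed.

Lemma sum_indz x A : (\sum_(v in A) Posz (x == v) = Posz (x \in A))%R.
Proof. by rewrite -sum_ind; elim/big_rec2: _ => // v m n _ ->; rewrite PoszD. Qed.
End Sums.

(** * Graphs with pre-directed arcs *)

Section Inst.
Variables V E : finType.
Variable k : nat.
Hypothesis k0 : 0 < k.

(* A graph on [verts] together with an extra vertex z0 that is not represented: [zi v] and
   [zo v] are the numbers of arcs z0 -> v and v -> z0, whose direction is imposed, and
   [tg v] is the net outflow wanted at v, arcs at z0 included, modulo 2k. Edges may be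
   loops; they are ignored. *)
Record inst := Inst { verts : {set V}; tl : E -> V; hd : E -> V;
  zi : V -> nat; zo : V -> nat; tg : V -> int }.
Implicit Types (G : inst) (A B : {set V}) (x y v a b : V) (e : E) (f : E -> bool).

Definition cross a b A : bool := (a \in A) != (b \in A).
Definition cut G A : nat := \sum_e cross (tl G e) (hd G e) A.
Definition zin G A : nat := \sum_(v in A) zi G v.
Definition zout G A : nat := \sum_(v in A) zo G v.
Definition deg G A : nat := cut G A + zin G A + zout G A.
Definition target G A : int := (\sum_(v in A) tg G v)%R.
(** The share of [tg] left to the edges between vertices: arcs from z0 count as inflow in [tg] and
    arcs to z0 as outflow. *)
Definition bal G v : int := (tg G v + Posz (zi G v) - Posz (zo G v))%R.
Definition sg (b : bool) : int := if b then 1%R else (- 1)%R.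
Definition term a b v : int := (Posz (a == v) - Posz (b == v))%R.
Definition net G f v : int := (\sum_e sg (f e) * term (tl G e) (hd G e) v)%R.
Definition solvable G := exists f, forall v, v \in verts G -> cong k (net G f v) (bal G v).
Definition nl G : nat := \sum_e (tl G e != hd G e).
(** Edges weigh 2 and arcs at z0 weigh 1, so that trading an edge for an arc at z0 is progress. *)
Definition meas G : nat := 2 * nl G + zin G (verts G) + zout G (verts G) + #|verts G|.
Definition wf G := forall e, tl G e != hd G e -> (tl G e \in verts G) && (hd G e \in verts G).

Definition override (F : E -> V) e a := fun e' => if e' == e then a else F e'.
Definition set_ends G e a b :=
  Inst (verts G) (override (tl G) e a) (override (hd G) e b) (zi G) (zo G) (tg G).
Definition set_data G i o t := Inst (verts G) (tl G) (hd G) i o t.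

(** The replaced term is added back on the left instead of being subtracted, so the identity also
    serves for counts in the natural numbers. *)
Lemma sum_override (M : nmodType) (F : V -> V -> M) (f g : E -> V) e a b :
  (\sum_e' F (override f e a e') (override g e b e') + F (f e) (g e) =
   \sum_e' F (f e') (g e') + F a b)%R.
Proof.
rewrite (bigD1 e) //= [in RHS](bigD1 e) //= {1 2}/override eqxx.
have -> : (\sum_(e' | e' != e) F (override f e a e') (override g e b e') =
           \sum_(e' | e' != e) F (f e') (g e'))%R.
  by apply: eq_bigr => e' /negbTE h; rewrite /override h.
by rewrite [LHS]addrC [RHS]addrAC -[RHS]addrA.
Qed.

Lemma cut_set_ends G e a b A :
  cut (set_ends G e a b) A + cross (tl G e) (hd G e) A = cut G A + cross a b A.
Proof. exact: (@sum_override nat (fun x y => cross x y A : nat)). Qed.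

Lemma nl_set_ends G e a b : nl (set_ends G e a b) + (tl G e != hd G e) = nl G + (a != b).
Proof. exact: (@sum_override nat (fun x y => x != y : nat)). Qed.

(** The edge keeps its index when its ends change, so an orientation of the modified graph becomes
    one of G by reassigning the direction of [e] alone. *)
Lemma net_set_ends G e a b f s v :
  let f' := fun e' => if e' == e then s else f e' in
  (net G f' v = net (set_ends G e a b) f v - sg (f e) * term a b v
                + sg s * term (tl G e) (hd G e) v)%R.
Proof.
rewrite /= /net /= (bigD1 e) //= eqxx [in RHS](bigD1 e) //= /override eqxx.
have -> : (\sum_(e' | e' != e) sg (if e' == e then s else f e') * term (tl G e') (hd G e') v =
  \sum_(e' | e' != e) sg (f e') * term (if e' == e then a else tl G e') (if e' == e then b else hd G e') v)%R.
  by apply: eq_bigr => e' /negbTE ->.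
by ring.
Qed.

Definition link G e y x := (tl G e == y) && (hd G e == x) || (tl G e == x) && (hd G e == y).

Lemma link_sym G e y x : link G e y x = link G e x y.
Proof. by rewrite /link orbC. Qed.

Lemma link_cross G e y x A : link G e y x -> cross (tl G e) (hd G e) A = cross y x A.
Proof. by rewrite /link /cross => /orP[/andP[/eqP-> /eqP->]|/andP[/eqP-> /eqP->]] //; rewrite eq_sym. Qed.

Lemma link_neq G e y x : link G e y x -> (tl G e != hd G e) = (y != x).
Proof. by rewrite /link => /orP[/andP[/eqP-> /eqP->]|/andP[/eqP-> /eqP->]] //; rewrite eq_sym. Qed.

Lemma link_vs G e y x : wf G -> link G e y x -> y != x -> (y \in verts G) /\ (x \in verts G).
Proof.
move=> w l n; have /(w e)/andP[] : tl G e != hd G e by rewrite (link_neq l).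
by move: l; rewrite /link => /orP[/andP[/eqP-> /eqP->]|/andP[/eqP-> /eqP->]].
Qed.

Lemma link_sg G e y x : link G e y x ->
  exists s, forall v, (sg s * term (tl G e) (hd G e) v = term y x v)%R.
Proof.
rewrite /link => /orP[/andP[/eqP-> /eqP->]|/andP[/eqP-> /eqP->]].
  by exists true => v; rewrite mul1r.
by exists false => v; rewrite /sg /term mulN1r opprB.
Qed.

Lemma cut_link G A : wf G -> 0 < cut G A ->
  exists e y x, [/\ link G e y x, y \in A, x \notin A, y \in verts G & x \in verts G].
Proof.
move=> w; rewrite lt0n sum_nat_eq0 => /forallPn[e]; rewrite /= eqb0 negbK => h.
have n : tl G e != hd G e by apply: contraTneq h => ->; rewrite /cross eqxx.
have /andP[v1 v2] := w e n.
move: h; rewrite /cross; case: (boolP (tl G e \in A)) => h1; case: (boolP (hd G e \in A)) => h2 // _.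
  by exists e, (tl G e), (hd G e); split=> //; rewrite /link !eqxx.
by exists e, (hd G e), (tl G e); split=> //; rewrite /link !eqxx orbT.
Qed.

(* Loops carry no flow, so an edge is deleted by turning it into a loop. *)
Lemma sol_del G e y x i o t : link G e y x ->
  (forall v, v \in verts G -> cong k (tg G v + Posz (zi G v) - Posz (zo G v))
     (t v + Posz (i v) - Posz (o v) + term y x v))%R ->
  solvable (set_data (set_ends G e y y) i o t) -> solvable G.
Proof.
move=> l hb [f hf]; have [s hs] := link_sg l.
exists (fun e' => if e' == e then s else f e') => v hv.
rewrite (net_set_ends G e y y) hs cong_sym.
apply: (cong_trans (hb v hv)); rewrite cong_sym.
have -> : (sg (f e) * term y y v = 0)%R by rewrite /term subrr mulr0.
by rewrite subr0; apply: congD; [apply: (hf v hv) | apply: congxx].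
Qed.

Lemma sol_set_data G i o t :
  (forall v, v \in verts G -> cong k (t v + Posz (i v) - Posz (o v)) (bal G v))%R ->
  solvable (set_data G i o t) -> solvable G.
Proof. by move=> hb [f hf]; exists f => v hv; apply: cong_trans (hf v hv) (hb v hv). Qed.

Lemma cut_vs G : wf G -> cut G (verts G) = 0.
Proof.
move=> w; apply: big1 => e _; rewrite /cross.
by have [->|/(w e)/andP[-> ->]] := eqVneq (tl G e) (hd G e); rewrite eqxx.
Qed.

Lemma cutD G A : wf G -> A \subset verts G -> cut G (verts G :\: A) = cut G A.
Proof.
move=> w s; apply: eq_bigr => e _; rewrite /cross !inE.
have [->|/(w e)/andP[-> ->]] := eqVneq (tl G e) (hd G e); first by rewrite !eqxx.
by rewrite !andbT; case: (_ \in A); case: (_ \in A).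
Qed.

Lemma sumDset (M : nmodType) (F : V -> M) (U A : {set V}) : A \subset U ->
  (\sum_(v in U) F v = \sum_(v in A) F v + \sum_(v in U :\: A) F v)%R.
Proof. by move=> s; rewrite (big_setID A) /= (setIidPr s). Qed.

Lemma targetD G A : A \subset verts G -> (target G (verts G :\: A) = target G (verts G) - target G A)%R.
Proof. by move=> s; rewrite /target (sumDset (tg G) s); ring. Qed.

Lemma zinD G A : A \subset verts G -> zin G A + zin G (verts G :\: A) = zin G (verts G).
Proof. by move=> s; rewrite /zin [RHS](@sumDset nat _ _ _ s). Qed.

Lemma zoutD G A : A \subset verts G -> zout G A + zout G (verts G :\: A) = zout G (verts G).
Proof. by move=> s; rewrite /zout [RHS](@sumDset nat _ _ _ s). Qed.

Lemma target1 G v : target G [set v] = tg G v. Proof. by rewrite /target big_set1. Qed.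
Lemma zin1 G v : zin G [set v] = zi G v. Proof. by rewrite /zin big_set1. Qed.
Lemma zout1 G v : zout G [set v] = zo G v. Proof. by rewrite /zout big_set1. Qed.

Lemma net_sum G f A : 
  (\sum_(v in A) net G f v =
   \sum_e sg (f e) * (Posz (tl G e \in A) - Posz (hd G e \in A)))%R.
Proof.
rewrite exchange_big /=; apply: eq_bigr => e _.
by rewrite -mulr_sumr sumrB !sum_indz.
Qed.

Lemma net_vs G f : wf G -> (\sum_(v in verts G) net G f v = 0)%R.
Proof.
move=> w; rewrite net_sum big1 // => e _.
have [->|/(w e)/andP[-> ->]] := eqVneq (tl G e) (hd G e); by rewrite subrr mulr0.
Qed.

End Inst.

(** * Restriction and contraction *)

Section Good.
Variables V E : finType.
Variable k : nat.
Hypothesis k3 : 2 < k.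
Let k0 : 0 < k. Proof. by lia. Qed.
Implicit Types (G : inst V E) (A B ex : {set V}) (x y v a b : V) (e : E) (f : E -> bool).

(* [normal] is the bound d(z0) <= 4k-2+|tau(z0)|; it is relaxed in [sourced] when z0 is a
   source sending many arcs to a single vertex x0. The set [ex] is empty or consists of
   the exceptional vertex v0, of target zero, which is allowed to have a small degree. *)
Definition normal G := zin G (verts G) + zout G (verts G) <= 4 * k - 2 + cdist k (target G (verts G)).
Definition sourced G x0 :=
  [/\ x0 \in verts G, zout G (verts G) = 0 & zin G (verts G) <= 4 * k - 2 + minn (zi G x0) k].
Definition exok G ex := ex = set0 \/
  exists v0, [/\ ex = [set v0], v0 \in verts G, cong k (tg G v0) 0 &
                 2 * (zi G v0 + zo G v0) <= deg G [set v0]].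
Definition conn G ex := forall A, A \subset verts G -> A != set0 -> A != verts G -> A != ex ->
  3 * k - 1 + cdist k (target G A) <= deg G A.
Definition par G := forall A, A \subset verts G -> odd (deg G A) = odd (cdist k (target G A)).
Definition balanced G := cong k (\sum_(v in verts G) bal G v)%R 0.

Record good G ex : Prop := Good {
  g_wf : wf G; g_bal : balanced G; g_par : par G; g_conn : conn G ex; g_ex : exok G ex;
  g_bd : normal G \/ exists x0, sourced G x0 /\ ex != [set x0] }.

(** Induction hypothesis of a strong induction on [meas], handed to the reductions. *)
Definition below G := forall G' ex, good G' ex -> meas G' < meas G -> solvable k G'.

Section Restrict.
Variables (G : inst V E) (A : {set V}) (f1 : E -> bool).

Definition inside e := (tl G e \in A) && (hd G e \in A).
Definition enters e B := cross (tl G e) (hd G e) A && (if f1 e then hd G e \in B else tl G e \in B).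
Definition leaves e B := cross (tl G e) (hd G e) A && (if f1 e then tl G e \in B else hd G e \in B).

(** Edges that are not inside A become loops, hence are ignored; those crossing A reappear as arcs
    at z0, directed by [f1]. *)
Definition restr : inst V E :=
  Inst A (tl G) (fun e => if inside e then hd G e else tl G e)
    (fun v => zi G v + \sum_e enters e [set v])
    (fun v => zo G v + \sum_e leaves e [set v]) (tg G).

Lemma sum_enters B : \sum_(v in B) \sum_e enters e [set v] = \sum_e enters e B.
Proof.
rewrite exchange_big /=; apply: eq_bigr => e _; rewrite /enters.
case: (cross _ _ _) => /=; last by rewrite big1_eq.
case: (f1 e); rewrite -sum_ind; apply: eq_bigr => v _; by rewrite inE.
Qed.

Lemma sum_leaves B : \sum_(v in B) \sum_e leaves e [set v] = \sum_e leaves e B.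
Proof.
rewrite exchange_big /=; apply: eq_bigr => e _; rewrite /leaves.
case: (cross _ _ _) => /=; last by rewrite big1_eq.
case: (f1 e); rewrite -sum_ind; apply: eq_bigr => v _; by rewrite inE.
Qed.

Lemma zin_restr B : zin restr B = zin G B + \sum_e enters e B.
Proof. by rewrite /zin /= big_split /= sum_enters. Qed.

Lemma zout_restr B : zout restr B = zout G B + \sum_e leaves e B.
Proof. by rewrite /zout /= big_split /= sum_leaves. Qed.

Lemma cut_restr B : B \subset A ->
  cut restr B + \sum_e enters e B + \sum_e leaves e B = cut G B.
Proof.
move=> /subsetP s; rewrite /cut -!big_split /=; apply: eq_bigr => e _.
rewrite /enters /leaves /cross /inside.
have /implyP : tl G e \in B -> tl G e \in A := s _.
have /implyP : hd G e \in B -> hd G e \in A := s _.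
case h1 : (tl G e \in A); case h2 : (hd G e \in A) => /=;
 case h3 : (tl G e \in B); case h4 : (hd G e \in B); case: (f1 e) => //=; rewrite ?h3 ?h4 //.
Qed.

Lemma deg_restr B : B \subset A -> deg restr B = deg G B.
Proof. by move=> s; rewrite /deg zin_restr zout_restr -(cut_restr s); lia. Qed.

Lemma net_restr f2 v : v \in A ->
  (net G (fun e => if inside e then f2 e else f1 e) v =
   net restr f2 v + Posz (\sum_e leaves e [set v]) - Posz (\sum_e enters e [set v]))%R.
Proof.
move=> vA.
have P (F : E -> nat) : (Posz (\sum_e F e) = \sum_e Posz (F e))%R.
  by elim/big_rec2: _ => // e m n _ <-; rewrite PoszD.
rewrite !P /net -big_split -sumrB /=; apply: eq_bigr => e _.
rewrite /leaves /enters /inside /cross /term !inE.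
have h1 : (tl G e == v) ==> (tl G e \in A) by apply/implyP => /eqP ->.
have h2 : (hd G e == v) ==> (hd G e \in A) by apply/implyP => /eqP ->.
move: h1 h2; case: (tl G e \in A); case: (hd G e \in A) => /=;
 case: (tl G e == v); case: (hd G e == v); case: (f1 e); case: (f2 e) => //=.
Qed.

Lemma net_restr' f2 v : v \notin A ->
  (net G (fun e => if inside e then f2 e else f1 e) v = net G f1 v)%R.
Proof.
move=> vA; apply: eq_bigr => e _; rewrite /inside /term.
case: ifP => // /andP[h1 h2].
by rewrite (negbTE (memPn vA _ h1)) (negbTE (memPn vA _ h2)) !subrr !mulr0.
Qed.

End Restrict.

(* The complement of A is absorbed into z0, its edges being oriented by f1. *)
Lemma restrict G A ex f1 : wf G -> balanced G -> par G -> conn G ex -> exok G ex ->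
  A \subset verts G -> A != set0 -> A != verts G ->
  deg G A <= 4 * k - 2 + cdist k (target G A) ->
  (forall v, v \in verts G -> v \notin A -> cong k (net G f1 v) (bal G v)) ->
  [\/ ex = set0, ex :&: A = set0 | deg G A = 3 * k - 1 + cdist k (target G A) /\ 1 < #|A|] ->
  below G -> solvable k G.
Proof.
move=> w bl pr cn xo sA nA nU dA hf xc IH.
set G2 := restr G A f1.
pose ex2 := if ex \subset A then ex else set0.
have hd2 B : B \subset A -> deg G2 B = deg G B by apply: deg_restr.
have ht B : target G2 B = target G B by [].
have bal2 v : (bal G2 v = bal G v + Posz (\sum_e enters G A f1 e [set v])
                 - Posz (\sum_e leaves G A f1 e [set v]))%R.
  by rewrite /bal /= !PoszD; ring.
have subU B : B \subset A -> B \subset verts G by move=> h; apply: subset_trans h sA.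
have sm : #|A| < #|verts G| by apply: proper_card; rewrite properEneq nU sA.
have w2 : wf G2.
  move=> e /=; rewrite /inside; case: ifP => [/andP[-> ->] //|_]; by rewrite eqxx.
have gd : good G2 ex2.
  split.
  - exact: w2.
  - rewrite /balanced.
    have e1 : (\sum_(v in A) bal G2 v = \sum_(v in A) (bal G v - net G f1 v))%R.
      have -> : (\sum_(v in A) bal G2 v = \sum_(v in A) (bal G v + net G2 f1 v - net G f1 v))%R.
        apply: eq_bigr => v vA; rewrite bal2.
        have := net_restr G f1 f1 vA.
        have -> : net G (fun e : E => if inside G A e then f1 e else f1 e) v = net G f1 v.
          by apply: eq_bigr => e _; case: ifP.
        move=> ->; rewrite -/G2; ring.
      rewrite (eq_bigr (fun v => (bal G v - net G f1 v) + net G2 f1 v)%R); last by move=> *; ring.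
      by rewrite big_split /= [X in (_ + X)%R](net_vs f1 w2) addr0.
    have := sumDset (fun v => bal G v - net G f1 v)%R sA.
    rewrite sumrB (net_vs f1 w) subr0 => e2.
    (* The imbalance on A is that of G plus a sum over the complement of A, where [f1] already meets
       the demands modulo 2k. *)
    have e3 : (\sum_(v in A) bal G2 v = \sum_(v in verts G) bal G v +
        \sum_(v in verts G :\: A) (net G f1 v - bal G v))%R.
      rewrite e1 e2 -addrA -big_split /= [X in (_ + X)%R]big1 ?addr0 // => v _; ring.
    have e4 : cong k (\sum_(v in verts G :\: A) (net G f1 v - bal G v))%R 0.
      rewrite -[X in cong _ _ X](_ : \sum_(v in verts G :\: A) 0 = 0)%R; last by rewrite big1.
      apply: cong_sum => v; rewrite inE => /andP[h1 h2].
      by have := congD (hf v h2 h1) (congxx k (- bal G v)%R); rewrite subrr.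
    by have := congD bl e4; rewrite addr0 -e3.
  - by move=> B sB; rewrite hd2 // ht; apply: pr; apply: subU.
  - move=> B sB nB nBA nBx; rewrite hd2 // ht; apply: cn; rewrite ?subU //.
      by apply: contra_neq nU => h; apply/eqP; rewrite eqEsubset sA -h sB.
    move: nBx; rewrite /ex2; case: ifP => // h _; by apply: contraFneq h => <-.
  - rewrite /ex2; case: ifP => // sx; last by left.
    case: xo => [->|[v0 [xe v0U c0 d0]]]; first by left.
    have v0A : v0 \in A by move: sx; rewrite xe sub1set.
    right; exists v0; split=> //.
    case: xc => [e|e|[dAe cA]].
    + by move/setP: e => /(_ v0); rewrite xe !inE eqxx.
    + by move/setP: e => /(_ v0); rewrite xe !inE eqxx v0A.
    have s1 : [set v0] \subset A by rewrite sub1set.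
    have sD : A :\ v0 \subset verts G2 by apply: subsetDl.
    (* As v0 has zero target, A without v0 has the same target as the tight set A, hence at least
       its degree. So v0 has at least as many edges to the rest of A as arcs at z0. *)
    have nD : 3 * k - 1 + cdist k (target G (A :\ v0)) <= deg G (A :\ v0).
      apply: cn.
      + exact: subU.
      + by apply: contraTneq cA => h; rewrite (cardsD1 v0) v0A h cards0.
      + apply: contraNneq nU => h; rewrite eqEsubset sA -h; exact: subsetDl.
      + by rewrite xe; apply: contraTneq (set11 v0) => <-; rewrite !inE eqxx.
    have ec : cut G2 (A :\ v0) = cut G2 [set v0] by apply: (cutD w2 (A:=[set v0])).
    have ei := zinD (G:=G2) s1; have eo := zoutD (G:=G2) s1.
    have eA : deg G2 A = zin G2 A + zout G2 A by rewrite /deg (cut_vs w2).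
    have : cdist k (target G (A :\ v0)) = cdist k (target G A).
      apply: (cong_cdist k0); have := targetD (G:=G2) s1; rewrite target1 !ht => ->.
      by rewrite -[X in cong _ _ X]subr0; apply: congD; [apply: congxx | apply: congN].
    have h1 := hd2 (A :\ v0) (subsetDl _ _); have h2 := hd2 A (subxx A).
    rewrite /= zin1 -/G2 in ei; rewrite /= zout1 -/G2 in eo.
    move: nD dAe h1 h2 eA ec; rewrite -/G2 /deg zin1 zout1.
    lia.
  (* The degree of A now consists of arcs at z0 only, so the bound assumed on it is exactly
     [normal]. *)
  - by left; rewrite /normal -[verts G2]/A; have := hd2 A (subxx A); rewrite /deg (cut_vs w2) ht => ->; rewrite ?ht.
(* Each crossing edge trades weight 2 for weight 1, and A is a proper subset of the vertices. *)
have ms : meas G2 < meas G.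
  have n1 : nl G2 + cut G A <= nl G.
    rewrite /nl /cut -big_split /=; apply: leq_sum => e _; rewrite /cross /inside.
    case h1 : (tl G e \in A); case h2 : (hd G e \in A) => /=; rewrite ?eqxx ?addn0 //=;
    by case: eqP => // e'; rewrite -e' h1 in h2.
  have := hd2 A (subxx A); rewrite /deg (cut_vs w2) /meas -[verts G2]/A.
  have := zinD sA; have := zoutD sA; lia.
have [f2 h2] := IH G2 ex2 gd ms.
exists (fun e => if inside G A e then f2 e else f1 e) => v vU.
have [vA|vA] := boolP (v \in A); last by rewrite net_restr' //; apply: hf.
rewrite net_restr //; have := h2 v vA; rewrite bal2 => h.
have := congD h (congxx k (Posz (\sum_e leaves G A f1 e [set v]) - Posz (\sum_e enters G A f1 e [set v]))%R).
by rewrite addrA; congr cong; ring.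
Qed.

End Good.

(** * Contracting a vertex set *)

Section Contract.
Variables V E : finType.
Variable k : nat.
Hypothesis k3 : 2 < k.
Let k0 : 0 < k. Proof. by lia. Qed.
Variables (G : inst V E) (A : {set V}) (a0 : V).
Hypothesis a0A : a0 \in A.
Hypothesis sA : A \subset verts G.
Hypothesis w : wf G.

Definition retract v := if v \in A then a0 else v.
Definition contr : inst V E :=
  Inst (a0 |: (verts G :\: A)) (fun e => retract (tl G e)) (fun e => retract (hd G e))
    (fun v => if v == a0 then zin G A else zi G v)
    (fun v => if v == a0 then zout G A else zo G v)
    (fun v => if v == a0 then target G A else tg G v).
(** For a set B of vertices of the contraction, this is the preimage of B under [retract] within the
    vertices of G. *)
Definition expand (B : {set V}) : {set V} := if a0 \in B then B :|: A else B.

Lemma sum_contr (M : nmodType) (F : V -> M) (B : {set V}) : B \subset verts contr ->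
  (\sum_(v in B) (if v == a0 then \sum_(v in A) F v else F v) = \sum_(v in expand B) F v)%R.
Proof.
move=> s; rewrite /expand; case: ifP => h; last first.
  by apply: eq_bigr => v vB; case: eqP => // e; rewrite -e vB in h.
rewrite (bigD1 a0) //= eqxx (@sumDset _ _ _ (B :|: A) A) ?subsetUr //; congr (_ + _)%R.
rewrite [RHS](eq_bigl (fun v => (v \in B) && (v != a0))).
  by apply: eq_bigr => v /andP[_ /negbTE ->].
move=> v; rewrite !inE; have [vB|] /= := boolP (v \in B); last by case: (v \in A).
have := subsetP s v vB; rewrite !inE; case: eqP => [->|_] /=; first by rewrite a0A.
by case/andP => ->.
Qed.

Lemma mem_retract v (B : {set V}) : v \in verts G -> B \subset verts contr ->
  (retract v \in B) = (v \in expand B).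
Proof.
move=> vU s; rewrite /retract /expand; have [vA|vA] := boolP (v \in A).
  case: (boolP (a0 \in B)) => h; first by rewrite inE vA orbT.
  apply/esym/negbTE; apply: contraNN h => vB.
  by have := subsetP s v vB; rewrite !inE vA /= orbF => /eqP <-.
by case: (a0 \in B); rewrite ?inE ?(negbTE vA) ?orbF.
Qed.

Lemma cut_contr (B : {set V}) : B \subset verts contr -> cut contr B = cut G (expand B).
Proof.
move=> s; apply: eq_bigr => e _; rewrite /cross /=.
have [->|/w/andP[h1 h2]] := eqVneq (tl G e) (hd G e); first by rewrite !eqxx.
by rewrite !mem_retract.
Qed.

Lemma deg_contr (B : {set V}) : B \subset verts contr -> deg contr B = deg G (expand B).
Proof. by move=> s; rewrite /deg cut_contr // /zin /zout [X in _ + X + _](@sum_contr nat) // [X in _ + _ + X](@sum_contr nat). Qed.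

Lemma target_contr (B : {set V}) : B \subset verts contr -> target contr B = target G (expand B).
Proof. exact: sum_contr. Qed.

Lemma expand_vs : expand (verts contr) = verts G.
Proof.
rewrite /expand /= setU11; apply/setP => v; rewrite !inE.
case: eqP => [->|_] /=; first by rewrite (subsetP sA).
by case: (boolP (v \in A)) => /= vA; rewrite ?orbT ?orbF // (subsetP sA v vA).
Qed.

Lemma expand_sub (B : {set V}) : B \subset verts contr -> expand B \subset verts G.
Proof.
move=> s; rewrite -expand_vs /expand /= setU11; case: ifP => _.
  by apply: setSU.
exact: subset_trans s (subsetUl _ _).
Qed.

Lemma expand_neq_vs (B : {set V}) : B \subset verts contr -> B != verts contr -> expand B != verts G.
Proof.
move=> s; apply: contraNN => /eqP h; rewrite eqEsubset s /=; apply/subsetP => v vU.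
have vV : v \in verts G.
  by move: vU; rewrite !inE; case/orP => [/eqP ->|/andP[]//]; apply: (subsetP sA).
have : retract v \in B by rewrite mem_retract // h.
by move: vU; rewrite !inE /retract; case/orP => [/eqP ->|/andP[/negbTE ->]] //; rewrite a0A.
Qed.

Lemma expand_neq0 (B : {set V}) : B != set0 -> expand B != set0.
Proof.
apply: contra_neq => h; apply/eqP; rewrite -subset0 -h /expand.
by case: ifP => // _; exact: subsetUl.
Qed.

(** Vertex sets of the contraction correspond to sets of G containing or avoiding A, with the same
    degree and target, so all conditions are inherited. *)
Lemma contr_good ex : good k G ex -> 1 < #|A| ->
  exists ex', good k contr ex' /\ meas contr < meas G.
Proof.
move=> [_ bl pr cn xo bd] cA.
have sV := subxx (verts contr).
have b1 v : (bal contr v = if v == a0 then \sum_(v in A) bal G v else bal G v)%R.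
  rewrite /bal /=; case: ifP => // _; rewrite sumrB big_split /= /zin /zout /target.
  have P (F : V -> nat) : (Posz (\sum_(v in A) F v) = \sum_(v in A) Posz (F v))%R.
    by elim/big_rec2: _ => // e m n _ <-; rewrite PoszD.
  by rewrite !P.
have zin1 : zin contr (verts contr) = zin G (verts G) by rewrite -expand_vs; apply: (@sum_contr nat).
have zout1 : zout contr (verts contr) = zout G (verts G) by rewrite -expand_vs; apply: (@sum_contr nat).
(* An exceptional vertex lying in A can be forgotten: sets containing A have at least two elements,
   so their bound holds without exception. *)
exists (if ex :&: A == set0 then ex else set0); split; last first.
  rewrite /meas zin1 zout1.
  have h1 : nl contr <= nl G.
    by apply: leq_sum => e _ /=; case: (eqVneq (tl G e) (hd G e)) => [->|_]; rewrite ?eqxx ?leq_b1.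
  have h2 : #|verts contr| < #|verts G|.
    rewrite cardsU1 !inE a0A /= cardsD (setIidPr sA); have := subset_leq_card sA; lia.
  lia.
split.
- move=> e /= h; have n : tl G e != hd G e by apply: contraNneq h => ->.
  have /andP[h1 h2] := w n.
  have h3 v : v \in verts G -> retract v \in verts contr.
    by move=> hv; rewrite /retract; case: ifP => h4; rewrite !inE ?eqxx // h4 hv orbT.
  by rewrite !h3.
- rewrite /balanced (eq_bigr (fun v => if v == a0 then \sum_(v in A) bal G v else bal G v)%R) //.
  by rewrite sum_contr // expand_vs.
- by move=> B s; rewrite deg_contr // target_contr // pr // expand_sub.
- move=> B s n0 nU nx; rewrite deg_contr // target_contr //; apply: cn; rewrite ?expand_sub ?expand_neq_vs ?expand_neq0 //.
  rewrite /expand; case: ifP => aB; last first.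
    apply: contraNneq nx => e0; case: ifP => [_|]; first by rewrite e0.
    case/negbT/set0Pn=> v; rewrite inE -e0 => /andP[vB vA].
    have := subsetP s v vB; rewrite !inE vA orbF => /eqP va.
    by rewrite va aB in vB.
  case: xo => [->|[v0 [xe _ _ _]]].
    by apply/set0Pn; exists a0; rewrite inE a0A orbT.
  rewrite xe; apply: contraTneq cA => h; rewrite -leqNgt -(cards1 v0) -h subset_leq_card // subsetUr //.
- case: ifP => h; last by left.
  case: xo => [->|[v0 [xe v0U c0 d0]]]; first by left.
  have nA : v0 \notin A by apply/negP => v0A; move/eqP/setP: h => /(_ v0); rewrite xe !inE eqxx v0A.
  have n0 : (v0 == a0) = false by apply: contraNF nA => /eqP ->.
  right; exists v0; split=> //=; rewrite ?n0 // ?deg_contr /expand ?sub1set !inE ?nA ?v0U ?n0 ?orbT //.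
  by rewrite eq_sym n0.
- case: bd => [h|[x0 [[h1 h2 h3] h4]]]; first by left; rewrite /normal zin1 zout1 target_contr // expand_vs.
  right; exists (retract x0); split.
    split; rewrite ?zin1 ?zout1 //.
      by rewrite /retract; case: ifP => h; rewrite !inE ?eqxx // h h1 orbT.
    apply: leq_trans h3 _; rewrite leq_add2l.
    rewrite leq_min geq_minr andbT; apply: leq_trans (geq_minl _ _) _ => /=.
    rewrite /retract; have [xA|xA] := boolP (x0 \in A).
      by rewrite eqxx /zin (bigD1 x0) //= leq_addr.
    by rewrite (_ : (x0 == a0) = false) //; apply: contraNF xA => /eqP ->.
  case: ifP => h; last first.
    by rewrite eq_sym; apply/set0Pn; exists (retract x0); rewrite inE.
  apply: contraNneq h4 => e; move: h; rewrite e /retract; case: ifP => // xA.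
  move/eqP/setP/(_ a0); by rewrite !inE eqxx a0A.
Qed.

Lemma net_contr f v : v \in verts G -> v \notin A -> net contr f v = net G f v.
Proof.
move=> vU vA; apply: eq_bigr => e _; congr (_ * _)%R; rewrite /term /= /retract.
have n0 : (a0 == v) = false by apply: contraNF vA => /eqP <-.
have P u : ((if u \in A then a0 else u) == v) = (u == v).
  by case: ifP => // uA; rewrite n0; apply/esym/negbTE; apply: contraNneq vA => <-.
by rewrite !P.
Qed.

End Contract.

(** * Tight sets *)

Section Tight.
Variables V E : finType.
Variable k : nat.
Hypothesis k3 : 2 < k.

(** Solving the contraction of A directs the edges not inside A; restricting to A directs the
    others. The restriction is allowed because 3k-1 is at most 4k-2. *)
Lemma tight_step (G : inst V E) ex (A : {set V}) : good k G ex -> A \subset verts G -> A != verts G ->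
  1 < #|A| -> deg G A = 3 * k - 1 + cdist k (target G A) -> below k G -> solvable k G.
Proof.
move=> gd sA nU cA dA IH; have [w bl pr cn xo _] := gd.
have /card_gt0P[a0 a0A] : 0 < #|A| by lia.
have [ex' [g' m']] := contr_good k3 a0A sA w gd cA.
have [f hf] := IH _ _ g' m'.
apply: (restrict k3 (A := A) (f1 := f)) xo _ _ _ _ _ _ IH => //.
- by apply/set0Pn; exists a0.
- by rewrite dA; lia.
- move=> v vU vA; rewrite -(net_contr (a0 := a0) a0A) //.
  have := hf v; rewrite /= !inE vU vA orbT => /(_ isT).
  by rewrite /bal /= (_ : (v == a0) = false) //; apply: contraNF vA => /eqP ->.
- by apply: Or33.
Qed.
End Tight.

(** * Reductions *)

Section Ops.
Variables V E : finType.
Variable k : nat.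
Hypothesis k3 : 2 < k.
Let k0 : 0 < k. Proof. by lia. Qed.
Implicit Types (G : inst V E) (A B ex : {set V}) (x y v a b : V) (e : E) (f : E -> bool).

Definition slack G := forall A, A \subset verts G -> A != verts G -> 1 < #|A| ->
  3 * k + 1 + cdist k (target G A) <= deg G A.

(** For odd k the number 3k-1 is even, so by [par] a degree that is not tight exceeds the bound by
    at least 2. Tight sets are handled by [tight_step]. *)
Lemma slackP G ex : odd k -> good k G ex -> below k G -> (slack G -> solvable k G) -> solvable k G.
Proof.
move=> kodd gd IH h.
have [|nt] := boolP [exists A : {set V}, [&& A \subset verts G, A != verts G, 1 < #|A| &
   deg G A == 3 * k - 1 + cdist k (target G A)]].
  by case/existsP => A /and4P[h1 h2 h3 /eqP h4]; apply: (tight_step k3 gd h1 h2 h3 h4 IH).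
apply: h => A h1 h2 h3; move/existsPn: nt => /(_ A); rewrite h1 h2 h3 /= => h4.
have [_ _ pr cn xo _] := gd.
have : 3 * k - 1 + cdist k (target G A) <= deg G A.
  apply: cn => //; first by apply: contraTneq h3 => ->; rewrite cards0.
  case: xo => [->|[v0 [-> _ _ _]]]; apply: contraTneq h3 => ->; by rewrite ?cards0 ?cards1.
have := pr A h1; move: h4; set d := deg G A; set n := cdist k _.
by lia.
Qed.

Lemma cdist_near (x d : int) : cdist k (x + d)%R <= cdist k x + `|d|.
Proof.
apply: leq_trans (cdistD k0 _ _) _; rewrite leq_add2l.
have P n : cdist k (Posz n) <= n.
  by have [h|h] := leqP n k; [rewrite cdist_small | apply: leq_trans (cdist_le k0 _) (ltnW h)].
by case: d => n //; rewrite NegzE cdistN // P.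
Qed.

Lemma cdist_near' (x d : int) : cdist k x <= cdist k (x + d)%R + `|d|.
Proof. by have := cdist_near (x + d)%R (- d)%R; rewrite addrK; lia. Qed.

(** Bookkeeping for a reduction: p is the new degree, q the old one, m the loss, n the gain, and d
    the change of target. *)
Lemma par_step (x d : int) (p q m n : nat) : p + m = q + n -> odd (m + n) = odd `|d| ->
  odd (p + cdist k (x + d)%R) = odd (q + cdist k x).
Proof.
move=> /(congr1 odd); have -> : odd `|d| = odd `|(x + d)%R| (+) odd `|x| by clear; lia.
rewrite -!(cdist_odd k0) !oddD.
by case: (odd p); case: (odd q); case: (odd m); case: (odd n); do 2 case: (odd (cdist _ _)).
Qed.

Lemma near_step (x d : int) (p q m n : nat) : p + m = q + n -> `|d| + m <= n + 2 ->
  q + cdist k (x + d)%R <= p + 2 + cdist k x.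
Proof. have := cdist_near x d; move: (cdist _ _) (cdist _ _) (`|d|) => a b c; clear; lia. Qed.

Lemma bumpT (x d : int) : (x + d * Posz true = x + d)%R. Proof. by rewrite mulr1. Qed.
Lemma bumpF (x d : int) : (x + d * Posz false = x)%R. Proof. by rewrite mulr0 addr0. Qed.

Lemma bal_sum G A : (\sum_(v in A) bal G v = target G A + Posz (zin G A) - Posz (zout G A))%R.
Proof.
have P (F : V -> nat) : (Posz (\sum_(v in A) F v) = \sum_(v in A) Posz (F v))%R.
  by elim/big_rec2: _ => // e m n _ <-; rewrite PoszD.
by rewrite /bal sumrB big_split /= /zin /zout !P.
Qed.

Lemma zi_le G v : v \in verts G -> zi G v <= zin G (verts G).
Proof. by move=> h; rewrite /zin (bigD1 v) //= leq_addr. Qed.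

Lemma zo_le G v : v \in verts G -> zo G v <= zout G (verts G).
Proof. by move=> h; rewrite /zout (bigD1 v) //= leq_addr. Qed.

(** Common frame of the reductions that keep the vertex set. Sets of at least two vertices have a
    surplus of 2 to spend, so only single vertices need an exact check. *)
Lemma good_upd G ex G' ex' : good k G ex -> slack G -> verts G' = verts G -> wf G' ->
  cong k (target G' (verts G) + Posz (zin G' (verts G)) - Posz (zout G' (verts G)))%R
       (target G (verts G) + Posz (zin G (verts G)) - Posz (zout G (verts G)))%R ->
  (forall A, A \subset verts G -> odd (deg G' A + cdist k (target G' A)) = odd (deg G A + cdist k (target G A))) ->
  (forall A, A \subset verts G -> A != verts G -> 1 < #|A| ->
    deg G A + cdist k (target G' A) <= deg G' A + 2 + cdist k (target G A)) ->
  ex = set0 \/ ex' = ex ->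
  (forall v, v \in verts G -> [set v] != ex' -> 3 * k - 1 + cdist k (tg G v) <= deg G [set v] ->
      3 * k - 1 + cdist k (tg G' v) <= deg G' [set v]) ->
  exok k G' ex' -> normal k G' \/ (exists x0, sourced k G' x0 /\ ex' != [set x0]) ->
  good k G' ex'.
Proof.
move=> [w bl pr cn xo bd] sl hv w' hb hp h2 hx h1 xo' bd'; split=> //.
- by rewrite /balanced hv bal_sum; apply: cong_trans hb _; rewrite -bal_sum.
- move=> A; rewrite hv => s; have := hp A s; have := pr A s.
  move: (deg G' A) (cdist k (target G' A)) (deg G A) (cdist k (target G A)) => p q r t; lia.
- move=> A; rewrite hv => s n0 nU nx.
  have [c1|c1] := ltnP 1 #|A|.
    by have := sl A s nU c1; have := h2 A s nU c1; lia.
  have /cards1P[v vA] : #|A| == 1 by move: n0; rewrite -card_gt0; lia.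
  have vU : v \in verts G by rewrite -sub1set -vA.
  rewrite vA target1; apply: h1; rewrite ?vU // -?vA //.
  rewrite -target1 -vA; apply: cn => //; case: hx => [->|<-] //.
Qed.

(* An arc z0 -> x is deleted. *)
Lemma zdel_step G x : good k G set0 -> slack G -> x \in verts G -> 0 < zi G x ->
  neg k (tg G x) || (3 * k + cdist k (tg G x) < deg G [set x]) -> below k G -> solvable k G.
Proof.
move=> gd sl xU ix hx IH; have [w bl pr cn xo bd] := gd.
pose i v := zi G v - 1 * (v == x).
pose t v := (tg G v + 1 * Posz (v == x))%R.
set G' := set_data G i (zo G) t.
have hi A : zin G' A + 1 * (x \in A) = zin G A by apply: sum_drop.
have ht A : (target G' A = target G A + 1 * Posz (x \in A))%R by apply: sum_bumpz.
have hd A : deg G' A + (x \in A) = deg G A + 0 by rewrite /deg -(hi A) -[cut G' A]/(cut G A) -[zout G' A]/(zout G A); lia.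
have i1 := hi (verts G); have t1 := ht (verts G); rewrite xU in i1 t1.
have o1 : zout G' (verts G) = zout G (verts G) by [].
apply: (@sol_set_data _ _ _ G i (zo G) t).
  move=> v _; rewrite /bal /i /t; apply: cong_eq.
  by case: eqP => [->|_]; lia.
apply: (IH G' set0); last first.
  change (2 * nl G + zin G' (verts G) + zout G (verts G) + #|verts G| < meas G); rewrite /meas; lia.
apply: (good_upd gd sl) => //.
- by apply: cong_eq; rewrite t1 o1 -i1; lia.
- by move=> A _; rewrite ht; apply: par_step (hd A) _; case: (x \in A).
- by move=> A _ _ _; rewrite ht; apply: near_step (hd A) _; case: (x \in A).
- by left.
- move=> v vU _; have := hd [set v]; rewrite inE /= /t [v == x]eq_sym; case: eqP => [<-|_] h1 h2.
    by case/orP: hx => [/(cdist_neg k0)|]; have := cdist_near (tg G x) 1; rewrite bumpT; lia.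
  by rewrite bumpF; lia.
- by left.
- case: bd => [bd|[x0 [[s1 s2 s3] s4]]].
    left; move: bd; rewrite /normal -[verts G']/(verts G) t1 o1 -i1.
    by have := cdist_near' (target G (verts G)) (1 * Posz true)%R; lia.
  right; exists x0; split => //; split=> //.
  rewrite -[verts G']/(verts G); move: s3; rewrite -i1 /= /i; case: eqP => [->|_]; lia.
Qed.

(* The edge yx is oriented from y to x and deleted. *)
Lemma del_step G e y x : good k G set0 -> slack G -> link G e y x -> y != x ->
  pos k (tg G y) -> neg k (tg G x) -> below k G -> solvable k G.
Proof.
move=> gd sl l yx py nx IH; have [w bl pr cn xo bd] := gd.
have [yU xU] := link_vs w l yx.
pose t v := (tg G v + (- 1) * Posz (v == y) + 1 * Posz (v == x))%R.
set G' := set_data (set_ends G e y y) (zi G) (zo G) t.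
have ht A : (target G' A = target G A + ((- 1) * Posz (y \in A) + 1 * Posz (x \in A)))%R.
  by rewrite /target /= /t !sum_bumpz addrA.
have hc A : cut G' A + cross y x A = cut G A.
  by have := cut_set_ends G e y y A; rewrite (link_cross _ l) /cross eqxx addn0.
have hd A : deg G' A + cross y x A = deg G A + 0.
  by rewrite /deg -(hc A) -[zout G' A]/(zout G A) -[zin G' A]/(zin G A); lia.
have t1 := ht (verts G); rewrite xU yU in t1.
apply: (sol_del (i := zi G) (o := zo G) (t := t) l).
  move=> v _; rewrite /t /term [v == y]eq_sym [v == x]eq_sym; apply: cong_eq; ring.
apply: (IH G' set0); last first.
  have := nl_set_ends G e y y; rewrite (link_neq l) yx eqxx.
  change (nl G' + true = nl G + ~~ true -> 2 * nl G' + zin G (verts G) + zout G (verts G) + #|verts G| < meas G); rewrite /meas; lia.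
apply: (good_upd gd sl) => //.
- move=> e' /=; rewrite /override; case: (e' == e); first by rewrite eqxx.
  exact: w.
- by apply: cong_eq; rewrite t1 -[zin G' _]/(zin G _) -[zout G' _]/(zout G _); lia.
- by move=> A _; rewrite ht; apply: par_step (hd A) _; rewrite /cross; case: (y \in A); case: (x \in A).
- by move=> A _ _ _; rewrite ht; apply: near_step (hd A) _; rewrite /cross; case: (y \in A); case: (x \in A).
- by left.
- move=> v vU _; have := hd [set v]; rewrite /cross !inE /= /t [v == x]eq_sym [v == y]eq_sym; case: (eqVneq y v) => [<-|_].
    rewrite [x == y]eq_sym (negbTE yx) => h1.
    by have := cdist_pos k0 py; rewrite bumpT bumpF; lia.
  case: (eqVneq x v) => [<-|_] h1.
    by have := cdist_neg k0 nx; rewrite bumpF bumpT; lia.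
  by rewrite !bumpF; lia.
- by left.
- case: bd => [bd|[x0 [[s1 s2 s3] s4]]].
    by left; move: bd; rewrite /normal -[verts G']/(verts G) t1 mulr1 mulr1 addNr addr0.
  by right; exists x0; split => //; split.
Qed.

(* The edge yx is oriented from y to x and replaced by an arc z0 -> x: this keeps the
   degree and the target of x. *)
Lemma pull_good G e y x : good k G set0 -> slack G -> link G e y x -> y != x ->
  pos k (tg G y) ->
  let G' := set_data (set_ends G e y y) (fun v => zi G v + 1 * (v == x)) (zo G)
              (fun v => tg G v + (- 1) * Posz (v == y))%R in
  (normal k G' \/ exists x0, sourced k G' x0) -> below k G -> solvable k G.
Proof.
move=> gd sl l yx py G' bd' IH; have [w bl pr cn xo bd] := gd.
have [yU xU] := link_vs w l yx.
have ht A : (target G' A = target G A + (- 1) * Posz (y \in A))%R by apply: sum_bumpz.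
have hi A : zin G' A = zin G A + 1 * (x \in A) by apply: sum_bump.
have hc A : cut G' A + cross y x A = cut G A.
  by have := cut_set_ends G e y y A; rewrite (link_cross _ l) /cross eqxx addn0.
have hd A : deg G' A + cross y x A = deg G A + (x \in A).
  by rewrite /deg -(hc A) -[zout G' A]/(zout G A) hi; lia.
have t1 := ht (verts G); have i1 := hi (verts G); rewrite yU in t1; rewrite xU in i1.
apply: (sol_del l) (IH G' set0 _ _).
- move=> v _; rewrite /term [v == y]eq_sym [v == x]eq_sym mul1n PoszD; apply: cong_eq; ring.
- apply: (good_upd gd sl) => //.
  + move=> e' /=; rewrite /override; case: (e' == e); first by rewrite eqxx.
    exact: w.
  + by apply: cong_eq; rewrite t1 i1 -[zout G' _]/(zout G _); lia.
  + by move=> A _; rewrite ht; apply: par_step (hd A) _; rewrite /cross; case: (y \in A); case: (x \in A).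
  + by move=> A _ _ _; rewrite ht; apply: near_step (hd A) _; rewrite /cross; case: (y \in A); case: (x \in A).
  + by left.
  + move=> v vU _; have := hd [set v]; rewrite /cross !inE /= [v == y]eq_sym; case: (eqVneq y v) => [<-|_].
      rewrite [x == y]eq_sym (negbTE yx) => h1.
      by have := cdist_pos k0 py; rewrite bumpT; lia.
    by rewrite bumpF; case: eqP; lia.
  + by left.
  + case: bd' => [|[x0 s]]; first by left.
    right; exists x0; split=> //; rewrite eq_sym; apply/set0Pn; exists x0; by rewrite inE.
- have := nl_set_ends G e y y; rewrite (link_neq l) yx eqxx.
  change (nl G' + true = nl G + ~~ true -> 2 * nl G' + zin G' (verts G) + zout G (verts G) + #|verts G| < meas G); rewrite /meas i1; lia.
Qed.

End Ops.

(** * Reversal and lifting at the exceptional vertex *)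

Section Exc.
Variables V E : finType.
Variable k : nat.
Hypothesis k3 : 2 < k.
Let k0 : 0 < k. Proof. by lia. Qed.
Implicit Types (G : inst V E) (A B ex : {set V}) (x y v a b : V) (e : E) (f : E -> bool).

Lemma par_same (p q m n t : nat) : p + m = q + n -> odd (m + n) = false ->
  odd (p + t) = odd (q + t).
Proof.
move=> /(congr1 odd); rewrite !oddD.
by case: (odd p); case: (odd q); case: (odd m); case: (odd n).
Qed.

Lemma near_same (p q m n t : nat) : p + m = q + n -> m <= n + 2 -> q + t <= p + 2 + t.
Proof. clear; lia. Qed.

Definition mirror G := Inst (verts G) (tl G) (hd G) (zo G) (zi G) (fun v => - tg G v)%R.

Lemma target_mirror G A : target (mirror G) A = (- target G A)%R.
Proof. by rewrite /target sumrN. Qed.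

Lemma deg_mirror G A : deg (mirror G) A = deg G A.
Proof. by rewrite /deg addnAC. Qed.

Lemma meas_mirror G : meas (mirror G) = meas G.
Proof. by rewrite /meas -[nl (mirror G)]/(nl G) [_ + zin (mirror G) _ + _]addnAC. Qed.

(** The condition [sourced] favours one direction at z0 and does not survive reversal, hence the
    restriction to [normal]. *)
Lemma good_mirror G ex : good k G ex -> normal k G -> good k (mirror G) ex.
Proof.
move=> [w bl pr cn xo _] nm; split=> //.
- have e : (\sum_(v in verts G) bal (mirror G) v = - \sum_(v in verts G) bal G v)%R.
    by rewrite -sumrN; apply: eq_bigr => v _; rewrite /bal /=; ring.
  by have := congN bl; rewrite oppr0 -e.
- by move=> A s; rewrite deg_mirror target_mirror cdistN // pr.
- by move=> A s n0 nU nx; rewrite deg_mirror target_mirror cdistN // cn.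
- case: xo => [->|[v0 [xe v0U c0 d0]]]; [by left | right; exists v0; split=> //].
    by move/congN: c0; rewrite oppr0.
  by rewrite deg_mirror /= addnC.
- by left; move: nm; rewrite /normal target_mirror cdistN // addnC.
Qed.

Lemma solvable_mirror G : solvable k (mirror G) -> solvable k G.
Proof.
case=> f hf; exists (fun e => ~~ f e) => v hv.
have -> : net G (fun e => ~~ f e) v = (- net (mirror G) f v)%R.
  by rewrite /net -sumrN; apply: eq_bigr => e _; rewrite -mulNr; case: (f e) => //=; rewrite opprK.
have -> : bal G v = (- bal (mirror G) v)%R by rewrite /bal /=; ring.
exact/congN/hf.
Qed.

Lemma below_mirror G : below k G -> below k (mirror G).
Proof. by move=> h G' ex g m; apply: h g _; rewrite -(meas_mirror G). Qed.

Lemma slack_mirror G : slack k G -> slack k (mirror G).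
Proof. by move=> h A s n c; rewrite deg_mirror target_mirror cdistN // h. Qed.

(** An isolated vertex of zero target makes no demand on the orientation, and once it is removed no
    exception remains. *)
Lemma drop_isolated G v0 : good k G [set v0] -> deg G [set v0] = 0 -> below k G -> solvable k G.
Proof.
move=> gd d0 IH; have [w bl pr cn xo bd] := gd.
case: xo => [/setP/(_ v0)|[v1 [/set1_inj e1 vU c0 _]]]; first by rewrite !inE eqxx.
move: vU c0; rewrite -{v1}e1 => vU c0.
have [cz iz oz] : [/\ cut G [set v0] = 0, zi G v0 = 0 & zo G v0 = 0].
  by move: d0; rewrite /deg zin1 zout1 => d1; split; clear -d1; lia.
have nx e : cross (tl G e) (hd G e) [set v0] = false.
  by move/eqP: cz; rewrite sum_nat_eq0 => /forallP/(_ e) /=; rewrite eqb0 => /negbTE.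
pose G' := Inst (verts G :\ v0) (tl G) (hd G) (zi G) (zo G) (tg G).
have s1 : [set v0] \subset verts G by rewrite sub1set.
have iD : zin G (verts G :\ v0) = zin G (verts G) by have := zinD s1; rewrite zin1 iz.
have oD : zout G (verts G :\ v0) = zout G (verts G) by have := zoutD s1; rewrite zout1 oz.
have tD : cdist k (target G (verts G :\ v0)) = cdist k (target G (verts G)).
  apply: (cong_cdist k0); rewrite targetD // target1 -[X in cong _ _ X]subr0.
  by apply: congD; [apply: congxx | apply: congN].
have b0 : cong k (bal G v0) 0 by rewrite /bal iz oz addr0 subr0.
have gd' : good k G' set0.
  split.
  - move=> e /= n; have /andP[h1 h2] := w e n; have := nx e.
    rewrite /cross !inE h1 h2 !andbT.
    case a: (tl G e == v0); case b: (hd G e == v0) => //= _.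
    by rewrite (eqP a) (eqP b) eqxx in n.
  - have := bl; rewrite /balanced (sumDset _ s1) big_set1 => h.
    have := congD h (congN b0); rewrite subrr.
    by congr cong; rewrite addrAC subrr add0r.
  - by move=> A /= sA; apply: pr; apply: subset_trans sA (subsetDl _ _).
  - move=> A /= sA n0 nU _; apply: cn => //.
    + exact: subset_trans sA (subsetDl _ _).
    + by apply: contraTneq sA => ->; apply/subsetPn; exists v0; rewrite ?inE ?eqxx.
    + by apply: contraTneq sA => ->; apply/subsetPn; exists v0; rewrite !inE ?eqxx.
  - by left.
  - case: bd => [bd|[x0 [[x1 x2 x3] x4]]].
      by left; rewrite /normal /= -[zin G' _]/(zin G _) -[zout G' _]/(zout G _) -[target G' _]/(target G _) iD oD tD.
    right; exists x0; split; last by rewrite eq_sym; apply/set0Pn; exists x0; rewrite inE.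
    split.
    + by rewrite !inE x1 andbT; apply: contraNneq x4 => ->.
    + by rewrite -x2 -oD.
    + by move: x3; rewrite -iD.
have [f hf] : solvable k G'.
  apply: IH gd' _; rewrite /meas /= -[zin G' _]/(zin G _) -[zout G' _]/(zout G _) iD oD -[nl G']/(nl G).
  by rewrite (cardsD1 v0 (verts G)) vU; lia.
exists f => v vU'; have [->|nv] := eqVneq v v0; last by apply: (hf v); rewrite !inE nv.
have -> : net G f v0 = 0%R.
  rewrite /net big1 // => e _; have := nx e; rewrite /cross /term !inE.
  by case: (tl G e == v0); case: (hd G e == v0) => //= _; rewrite mulr0.
by rewrite cong_sym.
Qed.

(* The path z0 v0 u is lifted to an arc z0 -> u. *)
Lemma lift_z G v0 e u : good k G [set v0] -> slack k G -> link G e v0 u -> v0 != u ->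
  0 < zi G v0 -> below k G -> solvable k G.
Proof.
move=> gd sl l n iz IH; have [w bl pr cn xo bd] := gd.
case: xo => [/setP/(_ v0)|[v1 [/set1_inj e1 v0U c0 d0]]]; first by rewrite !inE eqxx.
move: v0U c0 d0; rewrite -{v1}e1 => v0U c0 d0.
have [_ uU] := link_vs w l n.
pose i v := zi G v - 1 * (v == v0) + 1 * (v == u).
pose G' := set_data (set_ends G e v0 v0) i (zo G) (tg G).
have hi A : zin G' A + 1 * (v0 \in A) = zin G A + 1 * (u \in A).
  by rewrite /zin /= sum_bump addnAC sum_drop.
have hc A : cut G' A + cross v0 u A = cut G A.
  by have := cut_set_ends G e v0 v0 A; rewrite (link_cross _ l) /cross eqxx addn0.
have hd A : deg G' A + (cross v0 u A + (v0 \in A)) = deg G A + (u \in A).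
  by rewrite /deg -(hc A) -[zout G' A]/(zout G A); have := hi A; lia.
have i1 := hi (verts G); rewrite uU v0U in i1.
apply: (sol_del l) (IH G' [set v0] _ _).
- by move=> v _; rewrite /term /i [v == v0]eq_sym [v == u]eq_sym; apply: cong_eq; case: eqVneq => [<-|_]; lia.
- apply: (good_upd k3 gd sl) => //.
  + move=> e' /=; rewrite /override; case: (e' == e); first by rewrite eqxx.
    exact: w.
  + by apply: cong_eq; rewrite -[zout G' _]/(zout G _) -[target G' _]/(target G _); lia.
  + by move=> A _; rewrite -[target G' _]/(target G _); apply: par_same (hd A) _; rewrite /cross; case: (v0 \in A); case: (u \in A).
  + by move=> A _ _ _; rewrite -[target G' _]/(target G _); apply: near_same (hd A) _; rewrite /cross; case: (v0 \in A); case: (u \in A).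
  + by right.
  + move=> v vU nv; have := hd [set v]; rewrite /cross !inE -[tg G' _]/(tg G _).
    have -> : (v0 == v) = false by apply: contraNF nv => /eqP ->.
    by clear; case: (u == v); lia.
  (* v0 loses two units of degree and one arc at z0, so the inequality required of an exceptional
     vertex persists. *)
  + right; exists v0; split=> //; have := hd [set v0].
    have iv : zi G' v0 = zi G v0 - 1 by rewrite /= /i eqxx (negbTE n) addn0.
    rewrite /cross !inE eqxx [u == v0]eq_sym (negbTE n) -[zo G' _]/(zo G _) iv.
    by clear -d0 iz; lia.
  + case: bd => [bd|[x0 [[x1 x2 x3] x4]]].
      by left; move: bd; rewrite /normal -[verts G']/(verts G) -[target G' _]/(target G _) -[zout G' _]/(zout G _); lia.
    right; exists x0; split=> //; split=> //.
    have iv : zi G x0 <= zi G' x0.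
      have z : (x0 == v0) = false by apply: contraNF x4 => /eqP ->.
      by rewrite /= /i z subn0 leq_addr.
    by move: x3; rewrite -[verts G']/(verts G); clear -i1 iv; lia.
- have := nl_set_ends G e v0 v0; rewrite (link_neq l) n eqxx.
  change (nl G' + true = nl G + ~~ true -> 2 * nl G' + zin G' (verts G) + zout G (verts G) + #|verts G| < meas G); rewrite /meas; lia.
Qed.

(* The path u1 v0 u2 is lifted to an edge u1 u2, which is a loop when u1 = u2. *)
Lemma lift_pair G v0 e1 e2 u1 u2 : good k G [set v0] -> slack k G ->
  e1 != e2 -> link G e1 v0 u1 -> link G e2 v0 u2 -> v0 != u1 -> v0 != u2 ->
  (u1 = u2 -> 3 * k + 1 + cdist k (tg G u1) <= deg G [set u1]) ->
  zi G v0 = 0 -> zo G v0 = 0 -> below k G -> solvable k G.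
Proof.
move=> gd sl ne l1 l2 n1 n2 hu iz oz IH; have [w bl pr cn xo bd] := gd.
case: xo => [/setP/(_ v0)|[v1 [/set1_inj w1 v0U c0 d0]]]; first by rewrite !inE eqxx.
move: v0U c0 d0; rewrite -{v1}w1 => v0U c0 d0.
have [_ u1U] := link_vs w l1 n1; have [_ u2U] := link_vs w l2 n2.
pose G1 := set_ends G e2 v0 v0.
pose G' := set_ends G1 e1 u1 u2.
have l1' : link G1 e1 v0 u1 by move: l1; rewrite /link /= /override (negbTE ne).
have hc A : cut G' A + cross v0 u1 A + cross v0 u2 A = cut G A + cross u1 u2 A.
  have := cut_set_ends G e2 v0 v0 A; have := cut_set_ends G1 e1 u1 u2 A.
  have z : cross v0 v0 A = false by rewrite /cross eqxx.
  rewrite (link_cross _ l2) (link_cross _ l1') -/G' -/G1 z => a1 a2.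
  by clear -a1 a2; lia.
have hD A : deg G' A + (cross v0 u1 A + cross v0 u2 A) = deg G A + cross u1 u2 A.
  have a := hc A; rewrite /deg -[zout G' A]/(zout G A) -[zin G' A]/(zin G A).
  by clear -a; lia.
have [f hf] : solvable k G'.
  apply: (IH G' [set v0]).
    apply: (good_upd k3 gd sl) => //.
    + move=> e' /=; rewrite /override; case: (e' == e1); first by rewrite u1U u2U.
      case: (e' == e2); first by rewrite eqxx.
      exact: w.
    + by apply: cong_eq.
    + move=> A _; rewrite -[target G' _]/(target G _); apply: par_same (hD A) _; rewrite /cross.
      by case: (v0 \in A); case: (u1 \in A); case: (u2 \in A).
    + move=> A _ _ _; rewrite -[target G' _]/(target G _); apply: near_same (hD A) _; rewrite /cross.
      by case: (v0 \in A); case: (u1 \in A); case: (u2 \in A).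
    + by right.
    + move=> v vU nv; have := hD [set v]; rewrite /cross !inE -[tg G' _]/(tg G _).
      have -> : (v0 == v) = false by apply: contraNF nv => /eqP ->.
      case: (eqVneq u1 v) => [h1|_]; case: (eqVneq u2 v) => [h2|_]; try by clear; lia.
      by have := hu (etrans h1 (esym h2)); rewrite h1; clear -k3; lia.
    + by right; exists v0; split=> //=; rewrite iz oz.
  have := nl_set_ends G e2 v0 v0; have := nl_set_ends G1 e1 u1 u2.
  rewrite (link_neq l1') (link_neq l2) n1 n2 eqxx.
  change (nl G' + true = nl G1 + (u1 != u2) -> nl G1 + true = nl G + ~~ true ->
    2 * nl G' + zin G (verts G) + zout G (verts G) + #|verts G| < meas G).
  by rewrite /meas => a1 a2; clear -a1 a2; lia.
have [s1 hs1] := link_sg l1'; have [s2 hs2] := link_sg l2.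
(* The lifted edge, indexed by [e1], is replaced by a directed path through v0; [s1] and [s2] are
   the signs directing the two edges away from v0. *)
pose f1 e' := if e' == e1 then (if f e1 then ~~ s1 else s1) else f e'.
pose f2 e' := if e' == e2 then (if f e1 then s2 else ~~ s2) else f1 e'.
exists f2 => v vU.
rewrite /f2 (net_set_ends G e2 v0 v0) /f1 (net_set_ends G1 e1 u1 u2) -/G1 -/G'.
have z : term v0 v0 v = 0%R by rewrite /term subrr.
have sgN (c : bool) : sg (~~ c) = (- sg c)%R by case: c.
have -> : (net G' f v - sg (f e1) * term u1 u2 v
    + sg (if f e1 then ~~ s1 else s1) * term (tl G1 e1) (hd G1 e1) v
    - sg (if e2 == e1 then if f e1 then ~~ s1 else s1 else f e2) * term v0 v0 v
    + sg (if f e1 then s2 else ~~ s2) * term (tl G e2) (hd G e2) v)%R = net G' f v.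
  rewrite z mulr0 subr0; case: (f e1); rewrite ?sgN ?mulNr hs1 hs2 /sg /term; ring.
exact: hf.
Qed.

End Exc.

(** * Vertices of zero target *)

Section Absorb.
Variables V E : finType.
Variable k : nat.
Hypothesis k3 : 2 < k.
Let k0 : 0 < k. Proof. by lia. Qed.
Implicit Types (G : inst V E) (A B ex : {set V}) (x y v a b : V) (e : E) (f : E -> bool).

(** Direct j of the edges at v outwards and the remaining ones inwards. *)
Lemma orient_vertex G v j : j <= cut G [set v] ->
  exists f, (net G f v = 2 * Posz j - Posz (cut G [set v]))%R.
Proof.
move=> hj; pose S := [set e | cross (tl G e) (hd G e) [set v]].
have cS : cut G [set v] = #|S|.
  by rewrite /cut -[RHS]sum1_card [RHS]big_mkcond /=; apply: eq_bigr => e _; rewrite inE; case: cross.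
pose J := [set e in take j (enum S)].
have cJ : #|J| = j.
  rewrite cardsE (card_uniqP _) ?take_uniq ?enum_uniq // size_take -cardE -cS.
  by case: ltngtP hj.
have sJ : J \subset S.
  by apply/subsetP => e; rewrite inE => /mem_take; rewrite mem_enum.
exists (fun e => (e \in J) == (tl G e == v)).
have P (F : E -> nat) : (Posz (\sum_e F e) = \sum_e Posz (F e))%R.
  by elim/big_rec2: _ => // e m n _ <-; rewrite PoszD.
have cJ' : j = \sum_e (e \in J : nat).
  by rewrite -cJ -sum1_card [LHS]big_mkcond; apply: eq_bigr => e _; case: (e \in J).
rewrite {1}cJ' /cut !P mulr_sumr -sumrB; apply: eq_bigr => e _.
have := subsetP sJ e; case: (e \in J); rewrite [e \in S]inE /cross /term !inE.
  by move/(_ isT); case: (tl G e == v); case: (hd G e == v).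
by move=> _; case: (tl G e == v); case: (hd G e == v).
Qed.

(** Net outflows sum to zero and the demands sum to zero modulo 2k, so the congruence at the last
    vertex follows from the others. *)
Lemma solve_last G v0 f : wf G -> balanced k G -> v0 \in verts G ->
  (forall v, v \in verts G -> v != v0 -> cong k (net G f v) (bal G v)) -> solvable k G.
Proof.
move=> w bl v0U hf; exists f => v vU; have [->|] := eqVneq v v0; last exact: hf.
have := net_vs f w; rewrite (bigD1 v0) //= => n0.
have := bl; rewrite /balanced (bigD1 v0) //= => b0.
have h : cong k (\sum_(v in verts G | v != v0) net G f v)%R (\sum_(v in verts G | v != v0) bal G v)%R.
  by apply: cong_sum => u /andP[]; apply: hf.
set a := (\sum_(_ in _ | _) bal _ _)%R in b0 h.
have -> : net G f v0 = (- \sum_(v in verts G | v != v0) net G f v)%R.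
  by apply/eqP; rewrite -addr_eq0 n0.
have := congD b0 (congxx k (- a)%R); rewrite addrK add0r cong_sym => b1.
by apply: cong_trans b1; apply: congN.
Qed.

(** Liftings wear down the degree of v0. The inequality in [exok] provides an edge to pair with an
    arc at z0; once no such arc is left, the degree is even, so edges can be paired with each
    other. *)
Lemma exceptional G v0 : odd k -> good k G [set v0] -> below k G -> solvable k G.
Proof.
move=> kodd gd IH; apply: (slackP k3 kodd gd IH) => sl.
have [w bl pr cn xo bd] := gd.
have [d0|d0] := posnP (deg G [set v0]); first exact: (drop_isolated k3 gd d0 IH).
case: xo => [/setP/(_ v0)|[v1 [/set1_inj w1 v0U c0 dm]]]; first by rewrite !inE eqxx.
move: v0U c0 dm; rewrite -{v1}w1 => v0U c0 dm.
have fp : 0 < cut G [set v0].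
  by move: dm d0; rewrite /deg zin1 zout1; clear; lia.
have [e1 [y1 [u1 [l1 /set1P y1v n1 _ u1U]]]] := cut_link w fp.
rewrite {y1}y1v in l1; have n1' : v0 != u1 by apply: contraNneq n1 => ->; rewrite inE.
have [iz|iz] := posnP (zi G v0); last exact: (lift_z k3 gd sl l1 n1' iz IH).
have [oz|oz] := posnP (zo G v0); last first.
  have nm : normal k G.
    case: bd => // [[x0 [[_ o0 _] _]]].
    by have := zo_le v0U; rewrite o0; lia.
  apply: (@solvable_mirror _ _ _ G).
  apply: (@lift_z _ _ _ k3 (mirror G) v0 e1 u1) => //.
  - exact: good_mirror.
  - exact: slack_mirror.
  - exact: below_mirror.
have dE : deg G [set v0] = cut G [set v0] by rewrite /deg zin1 zout1 iz oz !addn0.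
have ev : odd (cut G [set v0]) = false.
  rewrite -dE pr ?sub1set // target1 (cong_cdist k0 c0) (@cdist_small _ k0 0) //.
pose S := [set e | cross (tl G e) (hd G e) [set v0]].
have cS : cut G [set v0] = #|S|.
  by rewrite /cut -[RHS]sum1_card [RHS]big_mkcond /=; apply: eq_bigr => e _; rewrite inE; case: cross.
have e1S : e1 \in S by rewrite inE (link_cross _ l1) /cross !inE eqxx [u1 == v0]eq_sym (negbTE n1').
have Sl e : e \in S -> exists u, link G e v0 u /\ v0 != u.
  rewrite inE /cross !inE; case: (eqVneq (tl G e) v0) => h1; case: (eqVneq (hd G e) v0) => h2 // _.
    by exists (hd G e); rewrite /link h1 !eqxx eq_sym.
  by exists (tl G e); rewrite /link h2 !eqxx orbT eq_sym.
have /card_gt0P[e2] : 0 < #|S :\ e1|.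
  have := cardsD1 e1 S; rewrite e1S -cS; move: ev fp; clear; case: (#|S :\ e1|); lia.
rewrite !inE => /andP[e21 e2S'].
have [|al] := boolP [exists e, (e \in S) && ~~ link G e v0 u1].
  case/existsP => e3 /andP[e3S l3]; have [u3 [l3' n3]] := Sl e3 e3S.
  apply: (@lift_pair _ _ _ k3 G v0 e1 e3 u1 u3) => //.
    by apply: contraNneq l3 => <-.
  by move=> e13; rewrite e13 l3' in l3.
have lall e : e \in S -> link G e v0 u1.
  by move=> eS; move/existsPn: al => /(_ e); rewrite eS negbK.
have l2 : link G e2 v0 u1 by apply: lall; rewrite inE.
(* All edges at v0 lead to u1. If there is a third vertex, u1 has at least the degree of {u1, v0},
   whose slack permits deleting two of these edges. Otherwise half of them are directed out of v0,
   and u1 takes care of itself. *)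
have [c3|c3] := ltnP 2 #|verts G|.
  apply: (@lift_pair _ _ _ k3 G v0 e1 e2 u1 u1) => //; first by rewrite eq_sym.
  move=> _; pose A := [set u1; v0].
  have sA : A \subset verts G by rewrite subUset !sub1set u1U v0U.
  have cA : #|A| = 2 by rewrite cards2 eq_sym n1'.
  have := sl A sA _ _; rewrite cA => /(_ _ isT) h.
  have {h} := h; have -> : A != verts G by apply: contraTneq c3 => <-; rewrite cA.
  move=> /(_ isT).
  have -> : cdist k (target G A) = cdist k (tg G u1).
    apply: (cong_cdist k0); rewrite /target big_setU1 ?big_set1 ?inE 1?eq_sym //=.
    by have := congD (congxx k (tg G u1)) c0; rewrite addr0.
  move=> h; apply: leq_trans h _; rewrite /deg zin1 zout1.
  have -> : zin G A = zi G u1 by rewrite /zin big_setU1 ?big_set1 ?inE 1?eq_sym //= iz addn0.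
  have -> : zout G A = zo G u1 by rewrite /zout big_setU1 ?big_set1 ?inE 1?eq_sym //= oz addn0.
  rewrite !leq_add2r; apply: leq_sum => e _.
  have := lall e; rewrite inE /link /cross !inE.
  have n1f := negbTE n1'; have n1f' : (u1 == v0) = false by rewrite eq_sym.
  case: (eqVneq (tl G e) v0) => h1; case: (eqVneq (hd G e) v0) => h2 /=; rewrite ?h1 ?h2 ?eqxx ?n1f ?orbT ?orbF ?andbF //=.
  - by move=> /(_ isT) ->.
  - by move=> /(_ isT); rewrite andbT => ->.
have lj : (cut G [set v0])./2 <= cut G [set v0] by clear; lia.
have [f hf] := orient_vertex lj.
have vE : verts G = [set v0; u1].
  apply/eqP; rewrite eq_sym eqEcard subUset !sub1set u1U v0U /= cards2 n1'.
  exact: c3.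
apply: (@solve_last G u1 f w bl u1U). move=> v; rewrite vE !inE => /orP[/eqP ->|->] // _.
rewrite hf /bal iz oz addr0 subr0.
have -> : (2 * Posz (cut G [set v0])./2 - Posz (cut G [set v0]) = 0)%R by move: ev; clear; lia.
by rewrite cong_sym.
Qed.

(** When no arc enters z0, the total target is minus the number of arcs leaving z0, modulo 2k. *)
Lemma sourced_cdist G (d : nat) : balanced k G -> zout G (verts G) = 0 ->
  cdist k (target G (verts G) - Posz d)%R = cdist k (Posz (zin G (verts G) + d)).
Proof.
rewrite /balanced bal_sum => bl o0; rewrite o0 subr0 in bl.
rewrite -(cdistN k0); apply: (cong_cdist k0).
have := congD (congN bl) (congxx k (Posz (zin G (verts G) + d))).
by rewrite oppr0 add0r; congr cong; rewrite PoszD; ring.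
Qed.

(** The only delicate case is a source z0 with s > 4k arcs: then s is at most 5k-2, so [cdist] takes
    the value s-4k and the bound is attained. *)
Lemma z_bound G ex : good k G ex ->
  zin G (verts G) + zout G (verts G) <= 4 * k + cdist k (target G (verts G)).
Proof.
case=> [w bl pr cn xo [h|[x0 [[x1 o0 h] _]]]]; first by move: h; rewrite /normal; lia.
rewrite o0 addn0; have [s|s] := leqP (zin G (verts G)) (4 * k); first by lia.
have := @sourced_cdist G 0 bl o0; rewrite subr0 addn0 => ->.
have -> : zin G (verts G) = (zin G (verts G) - 4 * k) + 2 * (2 * k) by lia.
rewrite cdist_nat // cdist_small //; first by lia.
by have := geq_minr (zi G x0) k; lia.
Qed.

(* Either the edges at y can be oriented and y absorbed into z0, or y may become the
   exceptional vertex. *)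
Lemma merge_or G y : odd k -> good k G set0 -> y \in verts G -> cong k (tg G y) 0 -> 1 < #|verts G| ->
  below k G -> (2 * (zi G y + zo G y) <= deg G [set y] -> solvable k G) -> solvable k G.
Proof.
move=> kodd gd yU c0 cU IH hyp; have zb := z_bound gd; have [w bl pr cn xo bd] := gd.
have s1 : [set y] \subset verts G by rewrite sub1set.
pose A := verts G :\ y.
have sA : A \subset verts G by apply: subsetDl.
have nA : A != set0 by rewrite -card_gt0; have := cardsD1 y (verts G); rewrite yU -/A; lia.
have nU : A != verts G by apply: contraTneq yU => <-; rewrite !inE eqxx.
have tA : cdist k (target G A) = cdist k (target G (verts G)).
  apply: (cong_cdist k0); rewrite /A targetD // target1 -[X in cong _ _ X]subr0.
  by apply: congD; [apply: congxx | apply: congN].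
have cA : cut G A = cut G [set y] by apply: cutD.
have := zinD s1; have := zoutD s1; rewrite zin1 zout1 -/A => oD iD.
have t0 : cdist k (tg G y) = 0 by rewrite (cong_cdist k0 c0) (@cdist_small _ k0 0).
have dA := cn A sA nA nU nA.
have dy : 3 * k - 1 <= deg G [set y].
  have n0 : [set y] != set0 by apply/set0Pn; exists y; rewrite inE.
  have := cn [set y] s1 n0 _ n0; rewrite target1 t0 addn0; apply.
  by apply: contraTneq cU => <-; rewrite cards1.
have py := pr [set y] s1; have pA := pr A sA.
rewrite target1 t0 in py; rewrite tA in pA dA.
(* If the degree of A exceeds this bound, parity lifts it to 4k plus [cdist], which is at least the
   number of arcs at z0 by [z_bound]. Hence y has at least as many edges to A as arcs at z0. *)
have [h|h] := leqP (deg G A) (4 * k - 2 + cdist k (target G A)); last first.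
  apply: hyp; move: h; rewrite tA; move: dA pA dy py zb; rewrite /deg cA zin1 zout1.
  move: (cdist k _) => n; move: kodd oD iD; clear -k3; lia.
(* The degrees of A and y together count the edges between them twice, besides at most 4k plus
   [cdist] arcs at z0; this leaves at least 2k-2. *)
have cK : k.-1 <= cut G [set y].
  move: h; rewrite tA; move: dA pA dy py zb; rewrite /deg cA zin1 zout1.
  move: (cdist k _) => n; move: oD iD; clear -k3; lia.
(* Directing r/2 edges out of y gives it net outflow r minus their number, as wanted modulo 2k.
   Since r is even and below 2k, r/2 is at most k-1. *)
pose r := residue k (bal G y + Posz (cut G [set y]))%R.
have rl : r < 2 * k by apply: residue_lt.
have [q hq] := residueP k0 (bal G y + Posz (cut G [set y]))%R; rewrite -/r in hq.
have re : odd r = false.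
  have e1 : odd `|(bal G y + Posz (cut G [set y]))%R| = odd (deg G [set y] + `|tg G y|).
    by rewrite /bal /deg zin1 zout1; clear; lia.
  have e2 : odd `|tg G y| = false by rewrite -(cdist_odd k0) t0.
  have e3 : odd `|(bal G y + Posz (cut G [set y]))%R| = odd r.
    by rewrite hq /modulus; clear; lia.
  by rewrite -e3 e1 oddD e2 py.
have lj : r./2 <= cut G [set y] by move: cK rl re; clear; lia.
have [f hf] := orient_vertex lj.
apply: (restrict k3 (A := A) (f1 := f) w bl pr cn xo) => //; last by apply: Or31.
move=> v vU; rewrite !inE vU andbT negbK => /eqP ->.
rewrite hf; apply/congP; exists (- q)%R.
have -> : bal G y = (q * modulus k + Posz r - Posz (cut G [set y]))%R by rewrite -hq addrK.
have -> : (2 * Posz r./2 = Posz r)%R by move: re; clear; lia.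
by ring.
Qed.

End Absorb.

(** * Orientations modulo k *)

Section Main.
Variables V E : finType.
Variable k : nat.
Hypothesis k3 : 2 < k.
Let k0 : 0 < k. Proof. by lia. Qed.
Implicit Types (G : inst V E) (A B ex : {set V}) (x y v a b : V) (e : E) (f : E -> bool).

Lemma cdist_shift (s q : nat) : q * (2 * k) <= s -> cdist k (Posz s) <= s - q * (2 * k).
Proof.
move=> h; rewrite -{1}(subnK h) cdist_nat //.
by have := cdist_near k3 0 (Posz (s - q * (2 * k)))%R; rewrite add0r (@cdist_small _ k0 0).
Qed.

Lemma cdist_top (s q : nat) : q * (2 * k) <= s -> s - q * (2 * k) <= k ->
  cdist k (Posz s) = s - q * (2 * k).
Proof. by move=> h1 h2; rewrite -{1}(subnK h1) cdist_nat // cdist_small. Qed.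

(** Here s+1-4k is at most k-1, so it is the value of [cdist] and equality holds. This gives
    [normal] after k of the s arcs leaving z0 are reversed, one is deleted and the total target
    drops by 1. *)
Lemma flip_bound s : 4 * k <= s -> s <= 5 * k - 2 -> s - 1 <= 4 * k - 2 + cdist k (Posz (s + 1)).
Proof.
by move=> h1 h2; rewrite (@cdist_top _ 2); [clear -h1 h2 k0; lia | clear -h1 h2 k0; lia ..].
Qed.

(* Reversing k arcs z0 -> x changes the net outflow of x by 2k, so it is harmless;
   one of the reversed arcs is then deleted, as x has positive target. *)
Lemma flip_pos G x : good k G set0 -> slack k G -> sourced k G x -> 4 * k <= zin G (verts G) ->
  k <= zi G x -> pos k (tg G x) -> below k G -> solvable k G.
Proof.
move=> gd sl [xU o0 bx] s4 kx px IH; have [w bl pr cn xo bd] := gd.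
pose i v := zi G v - k * (v == x).
pose o v := zo G v + (k - 1) * (v == x).
pose t v := (tg G v + (- 1) * Posz (v == x))%R.
pose G' := set_data G i o t.
have hi A : zin G' A + k * (x \in A) = zin G A by apply: sum_drop.
have ho A : zout G' A = zout G A + (k - 1) * (x \in A) by apply: sum_bump.
have ht A : (target G' A = target G A + (- 1) * Posz (x \in A))%R by apply: sum_bumpz.
have hD A : deg G' A + (x \in A) = deg G A + 0.
  rewrite /deg -(hi A) (ho A) -[cut G' A]/(cut G A).
  by clear -k0; case: (x \in A); lia.
have i1 := hi (verts G); have o1 := ho (verts G); have t1 := ht (verts G).
rewrite xU muln1 in i1; rewrite xU muln1 o0 add0n in o1; rewrite xU mulr1 in t1.
have hk : Posz (k - 1) = (Posz k - 1)%R by clear -k0; lia.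
apply: (@sol_set_data _ _ _ G i o t).
  move=> v _; rewrite /bal /i /o /t; apply/congP; exists (- Posz (v == x))%R.
  case: eqP => [->|_]; last by rewrite !muln0 subn0 addn0 (_ : Posz false = 0%R) //; ring.
  by rewrite !muln1 PoszD hk /modulus PoszM -(subzn kx) (_ : Posz true = 1%R) //; ring.
apply: (IH G' set0).
  apply: (good_upd k3 gd sl) => //.
  - apply/congP; exists (- 1)%R; rewrite t1 o1 o0 -i1 hk /modulus PoszM PoszD; ring.
  - by move=> A _; rewrite ht; apply: (par_step k3) (hD A) _; case: (x \in A).
  - by move=> A _ _ _; rewrite ht; apply: (near_step k3) (hD A) _; case: (x \in A).
  - by left.
  - move=> v vU _; have := hD [set v]; rewrite inE /= /t [v == x]eq_sym; case: eqP => [<-|_].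
      by have := cdist_pos k0 px; rewrite bumpT; clear; lia.
    by rewrite bumpF; clear; lia.
  - by left.
  - left; rewrite /normal -[verts G']/(verts G) t1 o1.
    rewrite (sourced_cdist k3 1) //.
    have /= h := @flip_bound (zin G (verts G)) s4 _; apply: leq_trans (h _).
      by clear -i1 k0; lia.
    by clear -bx k0; have := geq_minr (zi G x) k; lia.
rewrite /meas -[nl G']/(nl G) -[verts G']/(verts G) o1 o0 -i1; clear -k0; lia.
Qed.

(* As in [flip_pos], but x has target zero: one of the reversed arcs x -> z0 is deleted
   together with the edge yx, oriented from y to x, and x becomes exceptional. *)
Lemma flip_zero G x e y : good k G set0 -> slack k G -> sourced k G x -> 4 * k <= zin G (verts G) ->
  k <= zi G x -> cong k (tg G x) 0 -> 2 * zi G x <= deg G [set x] ->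
  link G e y x -> y != x -> pos k (tg G y) -> below k G -> solvable k G.
Proof.
move=> gd sl [xU o0 bx] s4 kx c0 dx l yx py IH; have [w bl pr cn xo bd] := gd.
have [yU _] := link_vs w l yx.
pose i v := zi G v - k * (v == x).
pose o v := zo G v + (k - 1) * (v == x).
pose t v := (tg G v + (- 1) * Posz (v == y))%R.
pose G' := set_data (set_ends G e y y) i o t.
have zx : zo G x = 0 by apply/eqP; rewrite -leqn0 -o0; apply: zo_le.
have hi A : zin G' A + k * (x \in A) = zin G A by apply: sum_drop.
have ho A : zout G' A = zout G A + (k - 1) * (x \in A) by apply: sum_bump.
have ht A : (target G' A = target G A + (- 1) * Posz (y \in A))%R by apply: sum_bumpz.
have hc A : cut G' A + cross y x A = cut G A.
  by have := cut_set_ends G e y y A; rewrite (link_cross _ l) /cross eqxx addn0.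
have hD A : deg G' A + (cross y x A + (x \in A)) = deg G A + 0.
  rewrite /deg -(hi A) (ho A) -(hc A).
  by clear -k0; case: (x \in A); lia.
have i1 := hi (verts G); have o1 := ho (verts G); have t1 := ht (verts G).
rewrite xU muln1 in i1; rewrite xU muln1 o0 add0n in o1; rewrite yU mulr1 in t1.
have hk : Posz (k - 1) = (Posz k - 1)%R by clear -k0; lia.
apply: (sol_del (i := i) (o := o) (t := t) l).
  move=> v _; rewrite /i /o /t /term [y == v]eq_sym [x == v]eq_sym cong_sym.
  apply/congP; exists (- Posz (v == x))%R.
  case: (v =P x) => [->|_]; last by rewrite !muln0 subn0 addn0 (_ : Posz false = 0%R) //; ring.
  by rewrite !muln1 PoszD hk /modulus PoszM -(subzn kx) (_ : Posz true = 1%R) //; ring.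
apply: (IH G' [set x]).
  apply: (good_upd k3 gd sl) => //.
  - move=> e' /=; rewrite /override; case: (e' == e); first by rewrite eqxx.
    exact: w.
  - apply/congP; exists (- 1)%R; rewrite t1 o1 o0 -i1 hk /modulus PoszM PoszD; ring.
  - by move=> A _; rewrite ht; apply: (par_step k3) (hD A) _; rewrite /cross; case: (y \in A); case: (x \in A).
  - by move=> A _ _ _; rewrite ht; apply: (near_step k3) (hD A) _; rewrite /cross; case: (y \in A); case: (x \in A).
  - by left.
  - move=> v vU nv; have := hD [set v]; rewrite /cross !inE /= /t [v == y]eq_sym.
    have -> : (x == v) = false by apply: contraNF nv => /eqP ->.
    case: (eqVneq y v) => [<-|_]; last by rewrite bumpF; clear; lia.
    by have := cdist_pos k0 py; rewrite bumpT; clear; lia.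
  (* In the target of x, the edge coming from y and the deleted arc to z0 cancel. The degree of x
     drops by 2 and its number of arcs at z0 by 1. *)
  - have tx : tg G' x = tg G x by rewrite /= /t [x == y]eq_sym (negbTE yx) mulr0 addr0.
    right; exists x; split=> //; first by rewrite tx.
    have := hD [set x]; rewrite /cross !inE eqxx (negbTE yx) /= /i /o eqxx zx muln1 muln1.
    by move: (deg G' _) => d h; clear -h dx kx k0; lia.
  - left; rewrite /normal -[verts G']/(verts G) t1 o1.
    rewrite (sourced_cdist k3 1) //.
    have /= h := @flip_bound (zin G (verts G)) s4 _; apply: leq_trans (h _).
      by clear -i1 k0; lia.
    by clear -bx k0; have := geq_minr (zi G x) k; lia.
have := nl_set_ends G e y y; rewrite (link_neq l) yx eqxx.
change (nl G' + true = nl G + ~~ true ->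
    2 * nl G' + zin G' (verts G) + zout G' (verts G) + #|verts G| < meas G).
by rewrite /meas o1 o0 -i1 => h; clear -h k0; lia.
Qed.

(** Without a crossing edge, the two sides would account for at least 6k-2 arcs at z0 beyond the
    [cdist] of the total target, against at most 4k by [z_bound]. *)
Lemma crossing G A : good k G set0 -> A \subset verts G -> A != set0 -> A != verts G -> 0 < cut G A.
Proof.
move=> gd sA nA nU; have zb := z_bound k3 gd; have [w bl pr cn xo bd] := gd.
rewrite lt0n; apply/negP => /eqP c0.
have sB : verts G :\: A \subset verts G by apply: subsetDl.
have nB : verts G :\: A != set0.
  by apply: contraNneq nU => /eqP; rewrite setD_eq0 eqEsubset sA.
have nBU : verts G :\: A != verts G.
  case/set0Pn: nA => v vA; apply/eqP => /setP/(_ v).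
  by rewrite inE vA (subsetP sA v vA).
have dA := cn A sA nA nU nA; have dB := cn _ sB nB nBU nB.
have := zinD sA; have := zoutD sA => oD iD.
have := cdistD k0 (target G A) (target G (verts G :\: A)); rewrite targetD // addrCA subrr addr0 -targetD //.
move: dA dB; rewrite /deg (cutD w sA) c0 !add0n.
by move: (cdist _ _) (cdist _ _) (cdist _ _) zb oD iD => a b c; clear -k3; lia.
Qed.

Lemma zero_step G y : odd k -> good k G set0 -> y \in verts G -> cong k (tg G y) 0 -> 1 < #|verts G| ->
  (normal k G \/ exists x0, sourced k G x0 /\ y != x0) -> below k G -> solvable k G.
Proof.
move=> kodd gd yU c0 c1 bd' IH; apply: (merge_or k3 kodd gd yU c0 c1 IH) => h.
apply: (exceptional k3 kodd (v0 := y) _ IH); have [w bl pr cn xo bd] := gd; split=> //.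
- by move=> A sA nA nU _; apply: cn.
- by right; exists y.
case: bd' => [|[x0 [s n]]]; [by left | right; exists x0; split=> //].
by apply: contraNneq n => /set1_inj ->.
Qed.

Lemma sum_gt0 (F : V -> nat) A : 0 < \sum_(v in A) F v -> exists2 v, v \in A & 0 < F v.
Proof.
rewrite lt0n sum_nat_eq0 => /forallPn[v]; rewrite negb_imply -lt0n => /andP[]; by exists v.
Qed.

(** An edge is pulled toward a vertex x that already receives an arc from z0, if there is one. The
    bound [normal] can fail only when the number of arcs grows from 4k-1 to 4k; then x receives two
    of them and [sourced] takes over. *)
Lemma source_pos_step G : good k G set0 -> slack k G -> normal k G -> 1 < #|verts G| ->
  zout G (verts G) = 0 -> (forall v, v \in verts G -> pos k (tg G v)) -> below k G -> solvable k G.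
Proof.
move=> gd sl nm c1 o0 hp IH; have [w bl pr cn xo bd] := gd.
have [x xU hx] : exists2 x, x \in verts G & zin G (verts G) = 0 \/ 0 < zi G x.
  have [z|/sum_gt0[x xU]] := posnP (zin G (verts G)); last by exists x => //; right.
  have /card_gt0P[x xU] : 0 < #|verts G| by apply: leq_trans c1.
  by exists x => //; left.
have cp : 0 < cut G [set x].
  apply: crossing => //; rewrite ?sub1set //; first by apply/set0Pn; exists x; rewrite inE.
  by apply: contraTneq c1 => <-; rewrite cards1.
have [e [x' [y [l /set1P xx nyx _ yU]]]] := cut_link w cp.
rewrite {x'}xx link_sym in l; have yx : y != x by move: nyx; rewrite inE.
pose G' := set_data (set_ends G e y y) (fun v => zi G v + 1 * (v == x)) (zo G)
              (fun v => tg G v + (- 1) * Posz (v == y))%R.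
suff h : normal k G' \/ exists x0, sourced k G' x0 by apply: (pull_good k3 gd sl l yx (hp y yU) h IH).
clear IH.
have hi : zin G' (verts G) = zin G (verts G) + 1.
  by have := sum_bump (zi G) 1 x (verts G); rewrite xU muln1.
have ht : (target G' (verts G) = target G (verts G) - Posz 1)%R.
  by have := sum_bumpz (tg G) (- 1)%R y (verts G); rewrite yU mulr1.
have n1 : cdist k (target G (verts G)) = cdist k (Posz (zin G (verts G))).
  by have := sourced_cdist k3 0 bl o0; rewrite subr0 addn0.
move: nm; rewrite /normal o0 addn0 n1 => nm.
have [h|h] := leqP (zin G (verts G) + 1) (4 * k - 2 + cdist k (Posz (zin G (verts G) + 1))).
  by left; rewrite -[verts G']/(verts G) hi ht sourced_cdist // -[zout G' _]/(zout G _) o0 addn0.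
right; exists x; split=> //; have zx : zi G' x = zi G x + 1 by rewrite /= eqxx.
rewrite -[verts G']/(verts G) hi zx.
have s1 : zin G (verts G) <= 4 * k - 1.
  have [h4|] := leqP (2 * (2 * k)) (zin G (verts G)); last by clear; lia.
  by have := cdist_shift h4; move: nm h4; clear -k0; lia.
have s2 : 4 * k - 2 < zin G (verts G).
  rewrite ltnNge; apply/negP => s2.
  have [e4|s3] := eqVneq (zin G (verts G)) (4 * k - 2); last first.
    by move: h s2 s3; clear; lia.
  move: h; have -> : cdist k (Posz (zin G (verts G) + 1)) = 1.
    rewrite e4 /cdist (@residueE k _ 1%R (2 * k - 1)); [by clear -k3; lia| by clear -k3; lia|].
    by rewrite /modulus; clear -k3; lia.
  by rewrite e4; clear -k3; lia.
case: hx => hx; first by move: s2; rewrite hx; clear -k3; lia.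
have : 2 <= minn (zi G x + 1) k by rewrite leq_min addn1 ltnS hx (ltnW k3).
by move: s1; clear -k3; move: (minn _ _); lia.
Qed.

Lemma inner_step G : odd k -> good k G set0 -> 1 < #|verts G| -> below k G -> solvable k G.
Proof.
move=> kodd gd c1 IH; apply: (slackP k3 kodd gd IH) => sl.
have [w bl pr cn xo bd] := gd.
have zdel v : v \in verts G -> 0 < zi G v -> neg k (tg G v) -> solvable k G.
  by move=> vU iv nv; apply: (zdel_step k3 gd sl vU iv _ IH); rewrite nv.
have [|nl] := boolP [exists v in verts G, (0 < zi G v) && neg k (tg G v)].
  by case/existsP => v /and3P[h1 h2 h3]; apply: zdel h3.
have nzi v : v \in verts G -> 0 < zi G v -> neg k (tg G v) = false.
  move=> vU iv; apply/negbTE; apply: contraNN nl => h.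
  by apply/existsP; exists v; rewrite vU iv h.
have [|np] := boolP [exists e, exists y, exists x, [&& link G e y x, y != x, pos k (tg G y) & neg k (tg G x)]].
  case/existsP => e /existsP[y /existsP[x /and4P[h1 h2 h3 h4]]].
  exact: (del_step k3 gd sl h1 h2 h3 h4 IH).
have npn e y x : link G e y x -> y != x -> pos k (tg G y) -> neg k (tg G x) = false.
  move=> h1 h2 h3; apply/negbTE; apply: contraNN np => h4.
  by apply/existsP; exists e; apply/existsP; exists y; apply/existsP; exists x; rewrite h1 h2 h3 h4.
(* In the normal state, once zero targets are excluded, an edge between the positive vertices and
   the rest would join opposite signs. So all signs agree, and up to reversal they are positive with
   z0 a source. *)
have [nm|nn] := boolP (zin G (verts G) + zout G (verts G) <= 4 * k - 2 + cdist k (target G (verts G))).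
  have [|nz] := boolP [exists v in verts G, cong k (tg G v) 0].
    by case/existsP => v /andP[h1 h2]; apply: (zero_step kodd gd h1 h2 c1 _ IH); left.
  have nzv v : v \in verts G -> cong k (tg G v) 0 = false.
    by move=> vU; apply/negbTE; apply: contraNN nz => h; apply/existsP; exists v; rewrite vU.
  have [|no] := boolP [exists v in verts G, (0 < zo G v) && pos k (tg G v)].
    case/existsP => v /and3P[h1 h2 h3]; apply: solvable_mirror.
    apply: (zdel_step k3 (good_mirror k3 gd nm) (slack_mirror k3 sl) h1 h2 _ (below_mirror IH)).
    by rewrite negE // opprK h3.
  have nzo v : v \in verts G -> 0 < zo G v -> pos k (tg G v) = false.
    move=> vU iv; apply/negbTE; apply: contraNN no => h.
    by apply/existsP; exists v; rewrite vU iv h.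
  pose P := [set v in verts G | pos k (tg G v)].
  have sP : P \subset verts G by apply/subsetP => v; rewrite inE => /andP[].
  have [Pe|Pe] := eqVneq P (verts G).
    have hp v : v \in verts G -> pos k (tg G v) by rewrite -Pe inE => /andP[].
    apply: source_pos_step => //; apply: big1 => v vU; apply/eqP; rewrite eqn0Ngt.
    by apply/negP => /(nzo v vU); rewrite hp.
  have [P0|P0] := eqVneq P set0.
    have hn v : v \in verts G -> neg k (tg G v).
      move=> vU; have := sgn3 k0 (tg G v); rewrite nzv //= => /orP[h|//].
      by have : v \in P; [rewrite inE vU | rewrite P0 inE].
    apply: solvable_mirror; apply: source_pos_step.
    - exact: good_mirror.
    - exact: slack_mirror.
    - by rewrite /normal target_mirror cdistN // addnC.
    - by [].
    - apply: big1 => v vU; apply/eqP; rewrite eqn0Ngt.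
      by apply/negP => /(nzi v vU); rewrite hn.
    - by move=> v vU /=; rewrite -negE // hn.
    - exact: below_mirror.
  have [e [y [x [l yP xP yU xU]]]] := cut_link w (crossing gd sP P0 Pe).
  have yx : y != x by apply: contraNneq xP => <-.
  move: yP xP; rewrite !inE yU xU /= => py npx.
  by have := sgn3 k0 (tg G x); rewrite nzv // (negbTE npx) (npn _ _ _ l yx py).
have [x [s _]] : exists x, sourced k G x /\ set0 != [set x].
  by case: bd => // h; case/negP: nn; apply: h.
have [xU o0 bx] := s.
have zx : zi G x <= zin G (verts G) by apply: zi_le.
(* With at most 4k-1 arcs leaving z0 the instance would be normal, since [cdist] of 4k-1 is 1. *)
have s4 : 4 * k <= zin G (verts G).
  rewrite leqNgt; apply/negP => h4; case/negP: nn; rewrite o0 addn0.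
  have := sourced_cdist k3 0 bl o0; rewrite subr0 addn0 => ->.
  have [h|h] := leqP (zin G (verts G)) (4 * k - 2); first by apply: leq_trans h (leq_addr _ _).
  have -> : zin G (verts G) = 4 * k - 1 by move: h h4; clear; lia.
  rewrite /cdist (@residueE k _ 1%R (2 * k - 1)); [by clear -k3; lia| by clear -k3; lia|].
  by rewrite /modulus; clear -k3; lia.
have [|nz] := boolP [exists v in verts G, (v != x) && cong k (tg G v) 0].
  case/existsP => v /and3P[h1 h2 h3]; apply: (zero_step kodd gd h1 h3 c1 _ IH).
  by right; exists x.
have nzv v : v \in verts G -> v != x -> cong k (tg G v) 0 = false.
  by move=> vU vx; apply/negbTE; apply: contraNN nz => h; apply/existsP; exists v; rewrite vU vx.
(* A vertex other than x that receives an arc from z0 has positive target. Edges leaving the set of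
   positive vertices other than x cannot end at a negative vertex, so one of them ends at x. *)
have nbr : zi G x < zin G (verts G) -> exists e y, [/\ link G e y x, y != x & pos k (tg G y)].
  move=> hx; have s1 : [set x] \subset verts G by rewrite sub1set.
  have : 0 < zin G (verts G :\ x) by move: hx; rewrite -(zinD s1) zin1; clear; lia.
  move/sum_gt0 => [v]; rewrite !inE => /andP[vx vU] iv.
  pose P := [set v in verts G | (v != x) && pos k (tg G v)].
  have sP : P \subset verts G by apply/subsetP => u; rewrite inE => /andP[].
  have vP : v \in P.
    by have := sgn3 k0 (tg G v); rewrite nzv // nzi // orbF inE vU vx.
  have P0 : P != set0 by apply/set0Pn; exists v.
  have Pe : P != verts G by apply: contraTneq xU => <-; rewrite !inE eqxx andbF.
  have [e [y [z [l yP zP yU zU]]]] := cut_link w (crossing gd sP P0 Pe).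
  have yz : y != z by apply: contraNneq zP => <-.
  move: yP zP; rewrite !inE yU zU /= => /andP[yx py].
  have [zx' _|nzx] := eqVneq z x; first by exists e, y; split=> //; rewrite -zx'.
  by have := sgn3 k0 (tg G z); rewrite nzv // (npn _ _ _ l yz py) orbF /= => ->.
have [xk|xk] := leqP k (zi G x); last first.
  have [|e [y [l yx py]]] := nbr; first by clear -xk s4; lia.
  have [yU _] := link_vs w l yx.
  apply: (pull_good k3 gd sl l yx py _ IH); right; exists x; split=> //.
  have -> : zin (set_data (set_ends G e y y) (fun v => zi G v + 1 * (v == x)) (zo G)
     (fun v => tg G v + -1 * Posz (v == y))%R) (verts G) = zin G (verts G) + 1.
    by have := sum_bump (zi G) 1 x (verts G); rewrite xU muln1.
  rewrite [zi _ x]/= eqxx (minn_idPl _); first by move: bx; rewrite (minn_idPl (ltnW xk)); clear; lia.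
  by rewrite muln1 addn1.
have ix : 0 < zi G x by apply: leq_trans xk.
have := sgn3 k0 (tg G x); rewrite nzi // orbF => /orP[c0|px]; last exact: (flip_pos gd sl s s4 xk px IH).
apply: (merge_or k3 kodd gd xU c0 c1 IH) => dx.
(* Either x has enough degree to lose an arc from z0, or its degree is at most 3k, so that not all
   of the 4k or more arcs of z0 go to x and a positive neighbour exists. *)
have [dl|dl] := ltnP (3 * k) (deg G [set x]).
  apply: (zdel_step k3 gd sl xU ix _ IH); rewrite (cong_cdist k0 c0) (@cdist_small _ k0 0) // addn0 dl orbT //.
have [|e [y [l yx py]]] := nbr; first by move: dx dl s4; clear -k3; lia.
apply: (flip_zero gd sl s s4 xk c0 _ l yx py IH); by apply: leq_trans dx; rewrite leq_mul2l leq_addr orbT.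
Qed.

Theorem good_solvable G ex : odd k -> good k G ex -> solvable k G.
Proof.
move=> kodd; have [n] := ubnP (meas G); elim: n G ex => // n IHn G ex le gd.
have IH : below k G by move=> G' ex' g' m'; apply: IHn g'; apply: leq_trans m' _.
have [w bl pr cn xo bd] := gd.
case: xo => [xe|[v0 [xe _ _ _]]]; last by apply: (exceptional k3 kodd (v0 := v0)) IH; rewrite -xe.
have [c1|c1] := ltnP 1 #|verts G|; first by apply: inner_step IH => //; rewrite -xe.
have [v0|/set0Pn[v vU]] := eqVneq (verts G) set0.
  by exists (fun=> true) => v; rewrite v0 inE.
apply: (solve_last (v0 := v) (f := fun=> true)) => // u uU; case/eqP.
by move/card_le1P: c1 => /(_ v vU u); rewrite uU inE => /esym/eqP.
Qed.

End Main.

(** * Passing from modulus 2k to modulus k *)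

Section Orient.
Variables V E : finType.
Variable k : nat.
Hypothesis k3 : 2 < k.
Hypothesis kodd : odd k.
Let k0 : 0 < k. Proof. by lia. Qed.
Variables (A : {set V}) (s t : E -> V) (beta : V -> int).
Hypothesis w : forall e, s e != t e -> (s e \in A) && (t e \in A).

(** With signs 2g-1, the net outflow is twice the sum over chosen edges minus the constant [tot].
    Targets 2 beta - [tot] modulo 2k thus have the right parity and yield the congruence modulo k
    after halving. *)
Lemma orient_cut :
  (forall B : {set V}, B \subset A -> B != set0 -> B != A ->
     4 * k - 2 <= \sum_e cross (s e) (t e) B) ->
  (Posz k %| (\sum_(v in A) beta v)%R)%Z ->
  exists g : E -> bool, forall v, v \in A ->
    (Posz k %| (\sum_e Posz (g e) * term (s e) (t e) v - beta v)%R)%Z.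
Proof.
move=> hc hb.
pose tot v : int := (\sum_e term (s e) (t e) v)%R.
pose G := Inst A s t (fun=> 0) (fun=> 0) (fun v => 2 * beta v - tot v)%R.
have z1 B : zin G B = 0 by apply: big1.
have z2 B : zout G B = 0 by apply: big1.
have dg B : deg G B = cut G B by rewrite /deg z1 z2 !addn0.
have tE B : (target G B = 2 * (\sum_(v in B) beta v) -
                \sum_e (Posz (s e \in B) - Posz (t e \in B)))%R.
  rewrite /target sumrB -mulr_sumr; congr (_ - _)%R.
  by rewrite exchange_big; apply: eq_bigr => e _; rewrite sumrB !sum_indz.
have pE B : odd (cut G B) = odd `|target G B|.
  rewrite tE.
  have -> : odd (cut G B) = odd `|(\sum_e (Posz (s e \in B) - Posz (t e \in B)))%R|.
    rewrite /cut; elim/big_rec2: _ => // e m n _; rewrite /cross /=.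
    by case: (s e \in B); case: (t e \in B) => /=; clear; lia.
  by clear; move: (\sum_(v in B) _)%R (\sum_e _)%R => x y; lia.
have gd : good k G set0.
  split.
  - exact: w.
  - rewrite /balanced bal_sum z1 z2 addr0 subr0 -[verts G]/A tE.
    have -> : (\sum_e (Posz (s e \in A) - Posz (t e \in A)) = 0)%R.
      apply: big1 => e _.
      by have [->|/w/andP[-> ->]] := eqVneq (s e) (t e); rewrite subrr.
    by rewrite subr0 /cong subr0 /modulus PoszM; apply: dvdz_mul.
  - by move=> B _; rewrite dg pE -(cdist_odd k0).
  (* The required degree is at most 4k-1, reached only if [cdist] is k; as k is odd, the cut is then
     odd and the bound 4k-2 improves by one. *)
  - move=> B sB n0 nU _; have := hc B sB n0 nU; rewrite -[\sum_e _]/(cut G B) dg.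
    have := cdist_le k0 (target G B); have := cdist_odd k0 (target G B); rewrite -pE.
    by move: kodd; move: (cdist _ _) (cut _ _) => x y; clear -k3; lia.
  - by left.
  - by left; rewrite /normal z1 z2.
have [f hf] := good_solvable k3 kodd gd.
exists f => v vA; have /congP[q] := hf v vA.
have -> : net G f v = (2 * (\sum_e Posz (f e) * term (s e) (t e) v) - tot v)%R.
  rewrite /net /tot mulr_sumr -sumrB; apply: eq_bigr => e _ /=.
  by case: (f e); rewrite /= ?mul1r ?mul0r ?mulr0 ?sub0r ?mulN1r //; ring.
rewrite /bal /= addr0 subr0; set x := (\sum_e _ * _)%R => h.
apply/dvdzP; exists q; move: h; rewrite /modulus PoszM; set y := tot v.
move: x y (beta v) => {}x {}y b h; have : (2 * (x - b) = 2 * (q * Posz k))%R.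
  have -> : (2 * (x - b) = (2 * x - y) - (2 * b - y))%R by ring.
  by rewrite h; ring.
by move/mulfI; apply.
Qed.
End Orient.

(** * Flows with two values per arc *)

Section Dense.
Variables V E : finType.
Variables (s t : E -> V) (F : {set E}) (c : nat).
Definition inner (A : {set V}) : {set E} := [set e in F | (s e \in A) && (t e \in A)].

(* A is a minimal set of vertices spanning more than c(|A| - 1) edges of F. *)
Lemma dense_connected (U : {set V}) : (forall e, e \in F -> s e != t e) ->
  c * #|U|.-1 < #|inner U| ->
  exists A : {set V}, [/\ A \subset U, 1 < #|A| &
    forall B : {set V}, B \subset A -> B != set0 -> B != A ->
      c < #|[set e in inner A | cross (s e) (t e) B]|].
Proof.
move=> nl hU; pose P := fun A : {set V} => (A \subset U) && (c * #|A|.-1 < #|inner A|).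
have PU : P U by rewrite /P subxx.
have [A mA _] := minset_exists PU.
have [/andP[sA hA] mn] := minsetP mA.
exists A; split=> //.
  rewrite ltnNge; apply/negP => /card_le1_eqP hA1.
  have : inner A = set0.
    apply/setP => e; rewrite !inE; apply/negP => /and3P[eF h1 h2].
    by have := nl e eF; rewrite (hA1 _ _ h1 h2) eqxx.
  by move=> h; rewrite h cards0 in hA.
move=> B sB B0 BA; set C := [set e in _ | _].
have nP (D : {set V}) : D \subset A -> D != A -> #|inner D| <= c * #|D|.-1.
  move=> sD nD; rewrite leqNgt; apply/negP => h; case/eqP: nD; apply: mn => //.
  by rewrite /P h (subset_trans sD sA).
have h1 := nP B sB BA.
have h2 : #|inner (A :\: B)| <= c * #|A :\: B|.-1.
  apply: nP; first exact: subsetDl.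
  case/set0Pn: B0 => v vB; apply/eqP => /setP/(_ v).
  by rewrite inE vB (subsetP sB v vB).
have h3 : inner A \subset inner B :|: inner (A :\: B) :|: C.
  apply/subsetP => e; rewrite !inE /cross => /and3P[-> -> ->] /=.
  by case: (s e \in B); case: (t e \in B).
have h4 : #|inner A| <= #|inner B| + #|inner (A :\: B)| + #|C|.
  apply: leq_trans (subset_leq_card h3) _.
  apply: leq_trans (leq_card_setU _ _) _; rewrite leq_add2r; exact: leq_card_setU.
have b0 : 0 < #|B| by rewrite card_gt0.
have a0 : 0 < #|A :\: B|.
  by rewrite card_gt0 setD_eq0; apply: contra BA => h; rewrite eqEsubset sB.
(* By minimality the two parts span at most c(|A|-2) edges together, so more than c edges cross
   between them. *)
have ab : #|A|.-1 = #|B|.-1 + #|A :\: B|.-1 + 1.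
  have := cardsID B A; rewrite (setIidPr sB); move: b0 a0; clear; lia.
move: hA; rewrite ab; move: h1 h2 h4; clear; move: #|_|.-1 #|_|.-1 => x y; nia.
Qed.
End Dense.

(** * Residues modulo an odd prime *)

Section Zp.
Variable p : nat.
Hypothesis pp : prime p.
Hypothesis p3 : 2 < p.
Let p1 : 1 < p. Proof. exact: prime_gt1. Qed.

Lemma Zp_dvd0 (x : int) : (Posz p %| x)%Z -> (x%:~R = 0 :> 'Z_p)%R.
Proof. by case/dvdzP => q ->; rewrite intrM -pmulrn pchar_Zp // mulr0. Qed.

Lemma Zp_dvdn (n : nat) : (n%:R = 0 :> 'Z_p)%R -> p %| n.
Proof. by move/(congr1 val) => /=; rewrite val_Zp_nat // => /eqP. Qed.

Lemma Zp_unit (c : 'Z_p) : (c != 0)%R -> (c \is a GRing.unit)%R.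
Proof.
move=> c0; rewrite -[c]natr_Zp unitZpE // prime_coprime //; apply: contra c0 => h.
have := ltn_ord c; rewrite [X in _ < X]Zp_cast // => cl.
by apply/eqP/val_inj; move: h; rewrite /dvdn modn_small // => /eqP.
Qed.

(** As p is odd, 2 is invertible. Hence each arc is counted for two different values of c in
    [large_class]. *)
Lemma Zp_neq_opp (c : 'Z_p) : (c != 0)%R -> (c != - c)%R.
Proof.
move=> c0; rewrite -addr_eq0 -mulr2n -mulr_natr mulrC.
apply: contraNneq c0 => h; have u : (2%:R : 'Z_p)%R \is a GRing.unit.
  by rewrite unitZpE // prime_coprime // gtnNdvd.
by rewrite -(mulKr u c) h mulr0.
Qed.
End Zp.

(** * Large weight classes and induction on the vertices *)

Section Flow.
Variables V E : finType.
Variable p : nat.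
Hypothesis pp : prime p.
Hypothesis p3 : 2 < p.
Let p1 : 1 < p. Proof. exact: prime_gt1. Qed.
Implicit Types (s t : E -> V) (d : E -> 'Z_p) (g : E -> bool).

Definition trm (a b v : V) : 'Z_p := ((a == v)%:R - (b == v)%:R)%R.
Definition flow s t d g v : 'Z_p := (\sum_e (g e)%:R * d e * trm (s e) (t e) v)%R.

Lemma trm_sum a b (B : {set V}) : (\sum_(v in B) trm a b v = (a \in B)%:R - (b \in B)%:R)%R.
Proof.
have P x : (\sum_(v in B) (x == v)%:R = (x \in B)%:R :> 'Z_p)%R by rewrite -natr_sum sum_ind.
by rewrite sumrB !P.
Qed.

Lemma flow_sum s t d g (B : {set V}) : (\sum_(v in B) flow s t d g v =
  \sum_e (g e)%:R * d e * ((s e \in B)%:R - (t e \in B)%:R))%R.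
Proof. by rewrite exchange_big /=; apply: eq_bigr => e _; rewrite -mulr_sumr trm_sum. Qed.

Lemma trm_int a b v : ((term a b v)%:~R = trm a b v)%R.
Proof. by rewrite /term /trm intrB -!pmulrn. Qed.

(** Summed over the p-1 nonzero c, the classes count each edge twice, as the degrees do. If all were
    small, the degree sum would be at most (p-1)(4p-3)(|U|-1), which is impossible since 6p-8 is at
    least 4p-3 for p at least 3. *)
Lemma large_class (U : {set V}) s t d : U != set0 -> (forall e, d e != 0)%R ->
  (forall e, s e != t e -> (s e \in U) && (t e \in U)) ->
  (forall v, v \in U -> (6 * p - 8) * (p - 1) <= \sum_e cross (s e) (t e) [set v]) ->
  exists2 c : 'Z_p, (c != 0)%R &
    (4 * p - 3) * #|U|.-1 < #|[set e | (s e != t e) && ((d e == c) || (d e == - c)%R)]|.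
Proof.
move=> U0 d0 w hU.
pose F (c : 'Z_p) := [set e | (s e != t e) && ((d e == c) || (d e == - c)%R)].
have [|no] := boolP [exists c : 'Z_p, (c != 0)%R && ((4 * p - 3) * #|U|.-1 < #|F c|)].
  by case/existsP => c /andP[c0 h]; exists c.
exfalso.
have u1 : (6 * p - 8) * (p - 1) * #|U| <= \sum_(v in U) \sum_e cross (s e) (t e) [set v].
  by rewrite mulnC -sum_nat_const; apply: leq_sum.
have u2 : \sum_(v in U) \sum_e cross (s e) (t e) [set v] <= \sum_(c : 'Z_p | c != 0%R) #|F c|.
  rewrite exchange_big (eq_bigr (fun c => \sum_e (e \in F c : nat))); last first.
    by move=> c _; rewrite -sum1_card big_mkcond; apply: eq_bigr => e _; case: (e \in F c).
  rewrite [X in _ <= X]exchange_big; apply: leq_sum => e _.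
  have [st|st] := eqVneq (s e) (t e).
    by rewrite big1 // => v _; rewrite /cross st eqxx.
  have /andP[sU tU] := w e st.
  apply: (@leq_trans 2).
    apply: (@leq_trans (\sum_(v in U) ((s e == v) + (t e == v)))).
      by apply: leq_sum => v _; rewrite /cross !inE; case: (s e == v); case: (t e == v).
    by rewrite big_split /= !sum_ind sU tU.
  rewrite (bigD1 (d e)) //= (bigD1 (- d e)%R) /=; last first.
    by rewrite oppr_eq0 d0 eq_sym Zp_neq_opp.
  by rewrite !inE st !eqxx opprK eqxx orbT.
have u3 : \sum_(c : 'Z_p | c != 0%R) #|F c| <= (p - 1) * ((4 * p - 3) * #|U|.-1).
  have -> : p - 1 = #|[pred c : 'Z_p | c != 0%R]|.
    have cZ : #|'Z_p| = p by rewrite card_ord Zp_cast.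
    by rewrite subn1 -{1}cZ -(cardC1 (0%R : 'Z_p)); apply: eq_card => c; rewrite !inE.
  rewrite -sum_nat_const; apply: leq_sum => c c0; rewrite leqNgt; apply: contra no => h.
  by apply/existsP; exists c; rewrite h andbT.
have n0 : 0 < #|U| by rewrite card_gt0.
have := leq_trans u1 (leq_trans u2 u3).
rewrite [(6 * p - 8) * _]mulnC -mulnA leq_pmul2l; last by rewrite subn_gt0.
by move: n0; clear -p3; case: #|U| => // n _ /=; nia.
Qed.

Theorem two_value_flow (U : {set V}) s t d (beta : V -> 'Z_p) : (forall e, d e != 0)%R ->
  (forall e, s e != t e -> (s e \in U) && (t e \in U)) ->
  (forall B : {set V}, B \subset U -> B != set0 -> B != U ->
     (6 * p - 8) * (p - 1) <= \sum_e cross (s e) (t e) B) ->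
  (\sum_(v in U) beta v = 0)%R ->
  exists g, forall v, v \in U -> flow s t d g v = beta v.
Proof.
have [n] := ubnP #|U|; elim: n => // n IHn in U s t beta *; rewrite ltnS => leU d0 w hc b0.
have kodd : odd p by case: (even_prime pp) => // p2; move: p3; rewrite p2.
have [c1|c1] := leqP #|U| 1.
  exists (fun=> true) => v vU.
  have e1 u : u \in U -> u = v by move=> uU; move/card_le1_eqP: c1; apply.
  have -> : beta v = 0%R.
    rewrite -b0 (bigD1 v) //= big1 ?addr0 // => u /andP[/e1 ->]; by rewrite eqxx.
  apply: big1 => e _; have [->|/w/andP[/e1 h1 /e1 h2]] := eqVneq (s e) (t e).
    by rewrite /trm subrr mulr0.
  by rewrite /trm h1 h2 subrr mulr0.
have U0 : U != set0 by rewrite -card_gt0; apply: leq_trans c1.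
have hv v : v \in U -> (6 * p - 8) * (p - 1) <= \sum_e cross (s e) (t e) [set v].
  move=> vU; apply: hc; rewrite ?sub1set //; first by apply/set0Pn; exists v; rewrite inE.
  by apply: contraTneq c1 => <-; rewrite cards1.
have [c c0 hF] := large_class U0 d0 w hv.
set F := [set e | _] in hF.
have nF e : e \in F -> s e != t e by rewrite inE => /andP[].
have iU : inner s t F U = F.
  apply/setP => e; rewrite [LHS]inE; case eF : (e \in F) => //=.
  exact: (w e (nF e eF)).
rewrite -iU in hF.
have [A [sA cA dA]] := dense_connected nF hF.
pose FA := inner s t F A.
have FAP e : e \in FA -> [/\ e \in F, s e \in A & t e \in A] by rewrite inE => /and3P.
have /card_gt0P[a0 a0A] : 0 < #|A| by apply: leq_trans cA.
(* No vertex z0 is involved here; the trivial data only give access to the lemmas on contraction. *)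
pose G := Inst U s t (fun=> 0) (fun=> 0) (fun=> 0%R).
pose G1 := contr G A a0.
pose beta1 v := if v == a0 then (\sum_(v in A) beta v)%R else beta v.
have [g1 hg1] : exists g, forall v, v \in verts G1 -> flow (tl G1) (hd G1) d g v = beta1 v.
  apply: IHn.
  - apply: leq_trans leU; rewrite cardsU1 !inE a0A /= cardsD (setIidPr sA).
    by have := subset_leq_card sA; move: cA; clear; lia.
  - exact: d0.
  - move=> e h; have n0 : s e != t e by apply: contraNneq h => h; rewrite /= h.
    have /andP[h1 h2] := w e n0.
    have h3 v : v \in U -> retract A a0 v \in verts G1.
      by move=> hv'; rewrite /retract; case: ifP => h4; rewrite !inE ?eqxx // h4 hv' orbT.
    by rewrite /= !h3.
  - move=> B sB B0 BU; rewrite -[\sum_e _]/(cut G1 B) cut_contr //.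
    apply: hc.
    + exact: (expand_sub (G := G) a0A sA sB).
    + exact: expand_neq0.
    + exact: (expand_neq_vs (G := G) a0A sA sB BU).
  - by rewrite (sum_contr (G := G) a0A) // (expand_vs (G := G) a0A sA).
have g1out v : v \in U -> v \notin A -> flow s t d g1 v = beta v.
  move=> vU vA; have va : v != a0 by apply: contraNneq vA => ->.
  have := hg1 v; rewrite !inE (negbTE va) vU vA /= /beta1 (negbTE va) => /(_ isT) <-.
  apply: eq_bigr => e _; congr (_ * _)%R; rewrite /trm /= /retract.
  have P u : ((if u \in A then a0 else u) == v) = (u == v).
    case: ifP => // uA; rewrite eq_sym (negbTE va); apply/esym/negbTE.
    by apply: contraNneq vA => <-.
  by rewrite !P.
have g1A : (\sum_(v in A) flow s t d g1 v = \sum_(v in A) beta v)%R.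
  have := hg1 a0; rewrite /beta1 !inE eqxx => /(_ isT) <-.
  rewrite flow_sum; apply: eq_bigr => e _; congr (_ * _)%R; rewrite /trm /= /retract.
  have P u : ((if u \in A then a0 else u) == a0) = (u \in A).
    by case: ifP => uA; rewrite ?eqxx //; apply/negbTE; apply: contraFneq uA => ->.
  by rewrite !P.
(* The values on FA are chosen anew to correct the flow inside A. *)
pose gout e := (e \notin FA) && g1 e.
pose rho v := (beta v - flow s t d gout v)%R.
(* Edges of [FA] have both ends in A, so dropping them does not affect the total outflow of A, which
   the contraction made correct. *)
have rho0 : (\sum_(v in A) rho v = 0)%R.
  rewrite /rho sumrB -g1A !flow_sum; apply/eqP; rewrite subr_eq0; apply/eqP.
  apply: eq_bigr => e _; rewrite /gout; case eF : (e \in FA) => //=.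
  by have [_ -> ->] := FAP e eF; rewrite subrr !mulr0.
(* Reversing the edges of weight -c makes all weights on [FA] equal to c; all other edges become
   loops. After division by c, an orientation problem modulo p remains. *)
pose s' e := if e \in FA then (if d e == c then s e else t e) else s e.
pose t' e := if e \in FA then (if d e == c then t e else s e) else s e.
pose b' v := Posz (c^-1 * rho v)%R.
have cu := Zp_unit pp c0.
have b'E v : ((b' v)%:~R = c^-1 * rho v :> 'Z_p)%R by rewrite /b' -pmulrn natr_Zp.
have crs e B : cross (s' e) (t' e) B = (e \in FA) && cross (s e) (t e) B.
  rewrite /s' /t'; case: ifP => _; last by rewrite /cross eqxx.
  by case: ifP => //= _; rewrite /cross eq_sym.
have [h hh] : exists g : E -> bool, forall v, v \in A ->
    (Posz p %| (\sum_e Posz (g e) * term (s' e) (t' e) v - b' v)%R)%Z.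
  apply: (orient_cut p3 kodd).
  - move=> e; rewrite /s' /t'; case eF: (e \in FA); last by rewrite eqxx.
    by have [_ h1 h2] := FAP e eF; case: ifP; rewrite h1 h2.
  - move=> B sB B0 BA; have := dA B sB B0 BA.
    have -> : \sum_e cross (s' e) (t' e) B = #|[set e in FA | cross (s e) (t e) B]|.
      rewrite -sum1_card [RHS]big_mkcond; apply: eq_bigr => e _.
      by rewrite crs inE; case: (_ && _).
    rewrite -/FA; clear -p3; lia.
  - have -> : (\sum_(v in A) b' v = Posz (\sum_(v in A) (c^-1 * rho v : 'Z_p)%R))%R.
      by elim/big_rec2: _ => // v m x _ ->; rewrite PoszD.
    suff z : p %| \sum_(v in A) (c^-1 * rho v : 'Z_p)%R by rewrite dvdzE.
    apply: Zp_dvdn => //; rewrite natr_sum.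
    rewrite (eq_bigr (fun v => c^-1 * rho v)%R); last by move=> v _; rewrite natr_Zp.
    by rewrite -mulr_sumr rho0 mulr0.
exists (fun e => if e \in FA then h e else g1 e) => v vU.
have [vA|vA] := boolP (v \in A); last first.
  rewrite -g1out //; apply: eq_bigr => e _; case: ifP => // eF.
  have [_ h1 h2] := FAP e eF; rewrite /trm.
  by rewrite (negbTE (memPn vA _ h1)) (negbTE (memPn vA _ h2)) subrr !mulr0.
have -> : (beta v = rho v + flow s t d gout v)%R by rewrite /rho subrK.
have -> : (rho v = c * (\sum_e Posz (h e) * term (s' e) (t' e) v)%:~R)%R.
  have := Zp_dvd0 pp (hh v vA); rewrite intrB b'E => /eqP; rewrite subr_eq0 => /eqP ->.
  by rewrite mulVKr.
rewrite rmorph_sum mulr_sumr -big_split /=; apply: eq_bigr => e _.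
rewrite intrM trm_int -pmulrn /gout /s' /t'; case eF : (e \in FA) => /=; last first.
  by rewrite /trm subrr !mulr0 add0r.
rewrite !mul0r addr0; have [eF' _ _] := FAP e eF.
move: eF'; rewrite inE => /andP[_]; case: eqP => [-> _|_ /= /eqP ->].
  by rewrite !mulrA [(c * _)%R]mulrC.
have -> : (trm (s e) (t e) v = - trm (t e) (s e) v)%R by rewrite /trm opprB.
by rewrite mulrN mulrN mulNr opprK mulrA [(c * _)%R]mulrC.
Qed.

End Flow.

(** * Lists of two values *)

Theorem theorem8 (p : nat) (V E : finType) (tail head : E -> V)
  (L : E -> {set 'Z_p}) :
  prime p -> (3 <= p)%N ->
  loopless tail head ->
  edge_connected tail head ((6 * p - 8) * (p - 1)) ->
  (forall e : E, #|L e| = 2%N) ->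
  forall beta : V -> 'Z_p, is_boundary beta ->
  exists f : E -> 'Z_p,
    is_flow_with_boundary tail head f beta /\ (forall e : E, f e \in L e).
Proof.
move=> pp p3 _ hc hL beta hb.
have p1 : 1 < p by apply: prime_gt1.
have [ab hab] : exists ab : E -> 'Z_p * 'Z_p, forall e, ((ab e).1 != (ab e).2) && (L e == [set (ab e).1; (ab e).2]).
  apply: (@fin_all_exists _ _ (fun e x => (x.1 != x.2) && (L e == [set x.1; x.2]))) => e.
  have /eqP/cards2P[a [b [n eL]]] := hL e.
  by exists (a, b); rewrite /= n eL eqxx.
(* The flow is split into a fixed part, taking the first value of each list, and a part that adds
   the nonzero difference [d] where the second value is chosen. *)
pose a e := (ab e).1; pose d e := ((ab e).2 - (ab e).1)%R.
pose base v := (\sum_e a e * trm p (tail e) (head e) v)%R.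
have d0 e : (d e != 0)%R by rewrite subr_eq0 eq_sym; case/andP: (hab e).
have flE (f : E -> 'Z_p) v : flow_boundary tail head f v = (\sum_e f e * trm p (tail e) (head e) v)%R.
  rewrite /flow_boundary big_mkcond [X in (_ - X)%R]big_mkcond -sumrB.
  apply: eq_bigr => e _; rewrite /trm mulrBr.
  by case: (tail e == v); case: (head e == v); rewrite ?mulr1 ?mulr0.
have [g hg] : exists g, forall v, v \in [set: V] -> flow tail head d g v = (beta v - base v)%R.
  apply: (two_value_flow pp p3) => //.
  - by move=> e; rewrite !inE.
  - move=> B _ B0 BU; have := hc B B0 BU; rewrite -sum1_card big_mkcond /=.
    congr (_ <= _); apply: eq_bigr => e _; rewrite inE /cross; by case: (_ != _).
  - rewrite sumrB (eq_bigl predT) => [|v]; last by rewrite inE.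
    rewrite [X in (X - _)%R]hb exchange_big big1 ?subr0 // => e _.
    by rewrite -mulr_sumr trm_sum !inE subrr mulr0.
exists (fun e => if g e then (ab e).2 else (ab e).1); split.
  move=> v; rewrite flE.
  have -> : (beta v = flow tail head d g v + base v)%R by rewrite hg ?inE // subrK.
  rewrite -big_split; apply: eq_bigr => e _ /=; rewrite -mulrDl /a /d.
  by case: (g e); rewrite ?mul1r ?mul0r ?add0r ?subrK.
by move=> e; have /andP[_ /eqP ->] := hab e; rewrite !inE; case: (g e); rewrite eqxx ?orbT.
Qed.
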